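(* Let $n\ge2$ and let $w=w_1w_2\cdots w_n\in\mathfrak{B}_n$. Then $w$ is minimal non-separable if and only if the following conditions hold: (a) $w_1w_2\cdots w_{n-1}$ avoids the patterns $\underline{2}1$ and $2\underline{1}$, and $w$ avoids the patterns $3142$, $2413$, $\underline{3}\,\underline{1}\,\underline{4}\,\underline{2}$, and $\underline{2}\,\underline{4}\,\underline{1}\,\underline{3}$; (b) there exists $i\in[n-1]$ such that $$\mathrm{sts}(w_iw_n)=\begin{cases}\underline{2}1,&\text{if }w_n>0,\\ 2\underline{1},&\text{if }w_n<0,\end{cases}$$ and for any $j,k,l$ with $1\le j<k<l<n$ we have $$\mathrm{sts}(w_jw_kw_lw_n)\notin\begin{cases}\{13\underline{4}2,\ 2\underline{3}41,\ \underline{1}3\underline{4}2,\ \underline{2}3\underline{4}1\},&\text{if }w_n>0,\\ \{\underline{1}\,\underline{3}4\underline{2},\ \underline{2}3\underline{4}\,\underline{1},\ 1\underline{3}4\underline{2},\ 2\underline{3}4\underline{1}\},&\text{if }w_n<0.\end{cases}$$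
   Context: Notation: $[n]=\{1,\dots,n\}$; an underlined number is negative, $\underline{k}=-k$. $\mathfrak{B}_n$ is the group (under composition, $(uv)(i)=u(v(i))$) of signed permutations of $[n]$, i.e. bijections $w$ of $\{\pm1,\dots,\pm n\}$ with $w(-i)=-w(i)$; one-line notation is $w=w_1\cdots w_n$ with $w_i=w(i)$, $i\in[n]$. $\mathfrak{B}_n$ is the Weyl group of type $B_n$, acting on $\mathbb{R}^n$ by $we_i=e_{w_i}$ with $e_{-i}=-e_i$, with root system $\Phi=\{\pm e_i\mid i\in[n]\}\cup\{\pm e_i\pm e_j\mid 1\le i<j\le n\}$, positive roots $\Phi^+=\{\pm e_i+e_j\mid 1\le i<j\le n\}\cup\{e_i\mid i\in[n]\}$, and simple roots $\Delta=\{\alpha_0=e_1\}\cup\{\alpha_i=-e_i+e_{i+1}\mid i\in[n-1]\}$. Separable elements: let $\Phi$ be a crystallographic root system with simple system $\Delta$, positive system $\Phi^+$ and Weyl group $W(\Phi)$. $I_\Phi(w)=\{\alpha\in\Phi^+\mid w\alpha\in-\Phi^+\}$; on $\Phi^+$, $\alpha\le\beta$ iff $\beta-\alpha$ is a nonnegative integral combination of simple roots. For a linear subspace $V$ of $\mathrm{span}(\Phi)$ and $\Phi'=\Phi\cap V$ (with positive system $\Phi^+\cap V$), $w|_{\Phi'}$ is the unique $w'\in W(\Phi')$ with $I_{\Phi'}(w')=I_\Phi(w)\cap V$. An element $w\in W(\Phi)$ is separable (recursively) if one of the following holds: (S1) $\Phi$ is of type $A_1$; (S2) $\Phi=\bigoplus\Phi_i$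 is reducible and $w|_{\Phi_i}$ is separable for each $i$; (S3) $\Phi$ is irreducible and there exists $\alpha_i\in\Delta$ such that $w|_{\Phi_J}\in W(\Phi_J)$ is separable, where $\Phi_J$ is the subsystem generated by $J=\Delta\setminus\{\alpha_i\}$, and either $\{\beta\in\Phi^+\mid\beta\ge\alpha_i\}\subset I_\Phi(w)$ (equality allowed) or $\{\beta\in\Phi^+\mid\beta\ge\alpha_i\}\cap I_\Phi(w)=\emptyset$. (The identity of the trivial group is regarded as separable.) Minimal non-separable: for $J\subseteq\Delta$, $W_J$ is the parabolic subgroup generated by $s_\alpha$, $\alpha\in J$ (the Weyl group of $\Phi_J$), and $w=w^Jw_J$ is the unique factorization with $w_J\in W_J$ and $w^J$ of minimal length in $wW_J$; one has $w_J=w|_{\Phi_J}$. An element $w$ of a Weyl group $W$ is minimal non-separable if $w$ is not separable but $w_J\in W_J$ is separable for all $J\subsetneq\Delta$. Patterns: for a sequence $a=a_1\cdots a_m$ of nonzero reals, the standard signed permutation $\mathrm{sts}(a)$ is the unique $v\in\mathfrak{B}_m$ with $\{i\mid v_i<0\}=\{i\mid a_i<0\}$ and, for all $1\le i<j\le m$, $|v_i|<|v_j|\Leftrightarrow|a_i|\le|a_j|$. A sequence $w_1\cdots w_r$ contains the pattern $u\in\mathfrak{B}_m$ if there are $1\le i_1<\cdots<i_m\le r$ with $\mathrm{sts}(w_{i_1}\cdots w_{i_m})=u$; otherwise it avoids $u$. *)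

(* Defs.v *)
From HB Require Import structures.
From mathcomp Require Import all_boot all_order all_algebra all_fingroup.
From mathcomp Require Import boolp classical_sets.

Set Implicit Arguments.
Unset Strict Implicit.
Unset Printing Implicit Defensive.

Import Order.TTheory GRing.Theory Num.Theory.
Local Open Scope classical_set_scope.
Local Open Scope ring_scope.

(** * Signed permutations and patterns *)

(* [(b, i) : letter n] encodes the element [(-1)^b * (i + 1)] of
   {-n, .., -1, 1, .., n}. *)
Definition letter (n : nat) : finType := (bool * 'I_n)%type.

Definition letter_opp n (x : letter n) : letter n := (~~ x.1, x.2).

Definition letter_int n (x : letter n) : int := (-1) ^+ x.1 * (x.2.+1)%:Z.

Record sperm (n : nat) := SPerm {
  sperm_perm :> {perm letter n};
  spermN : forall x, sperm_perm (letter_opp x) = letter_opp (sperm_perm x)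
}.

Definition one_line n (w : sperm n) : seq int :=
  [seq letter_int (w (false, i)) | i <- enum 'I_n].

(* The integer [w_i], with 1-based position [i]. *)
Definition at_pos n (w : sperm n) (i : nat) : int := (one_line w)`_(i.-1).

(* [sts a u] : [u] is the one-line notation of the standard signed permutation
   of [a], a sequence of nonzero numbers. *)
Definition sts (T : realDomainType) (a : seq T) (u : seq int) : Prop :=
  exists v : sperm (size a),
    [/\ u = one_line v,
        forall i, (i < size a)%N -> (u`_i < 0) = (a`_i < 0)
      & forall i j, (i < j < size a)%N ->
          (`|u`_i| < `|u`_j|) = (`|a`_i| <= `|a`_j|)].

Definition contains (T : realDomainType) (a : seq T) (u : seq int) : Prop :=
  exists2 b, subseq b a & sts b u.

Definition avoids (T : realDomainType) (a : seq T) (u : seq int) : Prop :=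
  ~ contains a u.

(** * Root systems and their Weyl groups *)

Section RootSystems.
Variables (R : realFieldType) (n : nat).
Local Notation V := 'cV[R]_n.
Local Notation M := 'M[R]_n.

Definition dot (u v : V) : R := \sum_i u i 0 * v i 0.

(* Matrix of [v |-> v - 2 (a, v) / (a, a) a], acting on column vectors. *)
Definition refl (a : V) : M := 1%:M - (2 / dot a a) *: (a *m a^T).

Definition linspan (X : set V) : set V :=
  [set v | exists2 s : seq V, (forall x, x \in s -> X x) & v \in <<s>>%VS].

(* Nonnegative integral combinations of [X], as sums of multisets. *)
Definition natspan (X : set V) : set V :=
  [set v | exists2 s : seq V, (forall x, x \in s -> X x) & v = \sum_(x <- s) x].

Definition refl_prod (s : seq V) : M := \big[mulmx/1%:M]_(a <- s) refl a.

(* The group generated by the reflections in the vectors of [X]; reflections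
   are involutions, so no inverses are needed. *)
Definition refl_group (X : set V) : set M :=
  [set w | exists2 s : seq V, (forall x, x \in s -> X x) & w = refl_prod s].

(* A root system with a positive system and the corresponding simple system.
   The axioms are not bundled: the notions below are meant for data that
   satisfy them, such as [rootsB] and its restrictions to spans of roots. *)
Record root_datum := RootDatum {
  roots : set V;
  pos : set V;
  simple : set V
}.

Implicit Types (D : root_datum) (w : M).

Definition weyl D : set M := refl_group (roots D).

Definition inversions D w : set V :=
  [set a | pos D a /\ pos D (- (w *m a))].

Definition root_le D (a b : V) : Prop := natspan (simple D) (b - a).

(* [simple D `&` U] is a simple system of [roots D `&` U] when [U] is spanned
   by simple roots or by a union of irreducible components, the only cases in
   which [simple] of a restriction is used. *)
Definition restrict D (U : set V) : root_datum :=
  RootDatum (roots D `&` U) (pos D `&` U) (simple D `&` U).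

(* [w'] is the restriction of [w] to [restrict D U]. *)
Definition is_restriction D (U : set V) w w' : Prop :=
  weyl (restrict D U) w' /\
  inversions (restrict D U) w' = inversions D w `&` U.

Definition orthogonal (X Y : set V) : Prop :=
  forall x y, X x -> Y y -> dot x y = 0.

Definition irreducible (X : set V) : Prop :=
  X !=set0 /\
  ~ exists Y Z : set V,
      [/\ X = Y `|` Z, Y !=set0, Z !=set0 & orthogonal Y Z].

Inductive separable : root_datum -> M -> Prop :=
| Separable_trivial D w :
    roots D = set0 -> weyl D w -> separable D w
| Separable_A1 D w (a : V) :
    a != 0 -> roots D = [set a] `|` [set - a] -> weyl D w -> separable D w
| Separable_reducible D w (k : nat) (X : 'I_k -> set V) (w_ : 'I_k -> M) :
    weyl D w -> (1 < k)%N -> roots D = \bigcup_i X i ->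
    (forall i, irreducible (X i)) ->
    (forall i j, i != j -> orthogonal (X i) (X j)) ->
    (forall i, is_restriction D (linspan (X i)) w (w_ i)) ->
    (forall i, separable (restrict D (linspan (X i))) (w_ i)) ->
    separable D w
| Separable_irreducible D w (a : V) (w' : M) :
    weyl D w -> irreducible (roots D) -> simple D a ->
    is_restriction D (linspan (simple D `\ a)) w w' ->
    separable (restrict D (linspan (simple D `\ a))) w' ->
    [set b | pos D b /\ root_le D a b] `<=` inversions D w \/
    [set b | pos D b /\ root_le D a b] `&` inversions D w = set0 ->
    separable D w.

(* [k] is the length of [w] with respect to the simple reflections. *)
Definition is_length D w (k : nat) : Prop :=
  (exists s : seq V,
     [/\ size s = k, forall x, x \in s -> simple D x & w = refl_prod s]) /\
  (forall s : seq V,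
     (forall x, x \in s -> simple D x) -> w = refl_prod s -> (k <= size s)%N).

(* [w = u *m v] with [v] in [W_J] and [u] of minimal length in [w W_J]. *)
Definition parabolic_factorization D (J : set V) w (u v : M) : Prop :=
  [/\ refl_group J v, w = u *m v
    & exists2 k, is_length D u k &
        forall x l, refl_group J x -> is_length D (w *m x) l -> (k <= l)%N].

Definition minimal_non_separable D w : Prop :=
  [/\ weyl D w, ~ separable D w
    & forall J, J `<` simple D ->
        exists u v, parabolic_factorization D J w u v /\
                    separable (restrict D (linspan J)) v].

End RootSystems.

(** * Type B *)

Section TypeB.
Variables (R : realFieldType) (n : nat).

Definition basis_vec (i : 'I_n) : 'cV[R]_n := delta_mx i 0.

Definition letter_vec (x : letter n) : 'cV[R]_n :=
  (-1) ^+ x.1 *: basis_vec x.2.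

Definition rootsB : root_datum R n := RootDatum
  [set v | (exists i (b : bool), v = (-1) ^+ b *: basis_vec i) \/
           (exists (i j : 'I_n) (b c : bool), (i < j)%N /\
              v = (-1) ^+ b *: basis_vec i + (-1) ^+ c *: basis_vec j)]
  [set v | (exists (i j : 'I_n) (b : bool), (i < j)%N /\
              v = (-1) ^+ b *: basis_vec i + basis_vec j) \/
           (exists i, v = basis_vec i)]
  [set v | (exists i : 'I_n, i = 0%N :> nat /\ v = basis_vec i) \/
           (exists i j : 'I_n, j = i.+1 :> nat /\
              v = - basis_vec i + basis_vec j)].

(* The linear map [e_i |-> e_{w_i}], where [e_{-i} = - e_i]. *)
Definition sperm_mx (w : sperm n) : 'M[R]_n :=
  \matrix_(k, i) letter_vec (w (false, i)) k 0.

End TypeB.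

(* Main.v *)
(** For [w] in the Weyl group put [x i := dot rho (w *m e_i)], where [rho] is
    positive on the simple roots; for a signed permutation [x] is its one-line
    notation. Whether a root is an inversion of [w] can be read off the signs
    of the sums and differences of the [x i].

    On a subsystem spanned by simple roots, [w] is separable if and only if [x]
    has, among the positions whose roots belong to the subsystem, neither a
    mixed inversion (positions [i < j] with [x i], [x j] of opposite signs and
    [`|x j| < `|x i|]) nor a crossing (an occurrence of 3142 or 2413 for the
    order of the signed values). If separability rests on a simple root [a], a
    bad configuration involving [a] contains two roots above [a] of which exactly
    one is an inversion. Conversely, a crossing-free word of type A is a direct
    or skew sum, which provides the pivot, and in type B the pivot is the last
    change of sign.

    Since [w_J] is the restriction of [w], the maximal parabolic subgroups
    obtained by dropping the first and the last simple root show that [w] is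
    minimal non-separable exactly when it has no crossing, no mixed inversion
    before position [n], and some mixed inversion. Once the first [n - 1]
    letters have no mixed inversion, a crossing is either of constant sign or
    ends at position [n] with one of the eight patterns of (b). *)

From mathcomp Require Import all_boot all_order all_algebra all_fingroup.
From mathcomp Require Import ring lra zify.
From mathcomp Require Import boolp classical_sets.
Require Import Defs.

Set Implicit Arguments.
Unset Strict Implicit.
Unset Printing Implicit Defensive.

Import Order.TTheory GRing.Theory Num.Theory.
Local Open Scope classical_set_scope.
Local Open Scope ring_scope.

(** * Euclidean geometry and reflections *)

Section Euclidean.
Variables (R : realFieldType) (n : nat).
Local Notation V := 'cV[R]_n.
Local Notation M := 'M[R]_n.
Implicit Types (u v a b r : V) (g w : M) (X : set V) (s : seq V).

Lemma dotC u v : dot u v = dot v u.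
Proof. by apply: eq_bigr => i _; rewrite mulrC. Qed.

Lemma dotDr u v1 v2 : dot u (v1 + v2) = dot u v1 + dot u v2.
Proof. by rewrite -big_split; apply: eq_bigr => i _; rewrite mxE mulrDr. Qed.

Lemma dotZr c u v : dot u (c *: v) = c * dot u v.
Proof. by rewrite mulr_sumr; apply: eq_bigr => i _; rewrite mxE mulrCA. Qed.

Lemma dotNr u v : dot u (- v) = - dot u v.
Proof. by rewrite -scaleN1r dotZr mulN1r. Qed.

Lemma dotBr u v1 v2 : dot u (v1 - v2) = dot u v1 - dot u v2.
Proof. by rewrite dotDr dotNr. Qed.

Lemma dot0r u : dot u 0 = 0.
Proof. by rewrite -(scale0r 0) dotZr mul0r. Qed.

Lemma dot_sumr I (l : seq I) (F : I -> V) u :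
  dot u (\sum_(i <- l) F i) = \sum_(i <- l) dot u (F i).
Proof.
by elim: l => [|x l IH]; rewrite ?big_nil ?dot0r // !big_cons dotDr IH.
Qed.

Lemma dotDl u1 u2 v : dot (u1 + u2) v = dot u1 v + dot u2 v.
Proof. by rewrite !(dotC _ v) dotDr. Qed.

Lemma dotZl c u v : dot (c *: u) v = c * dot u v.
Proof. by rewrite !(dotC _ v) dotZr. Qed.

Lemma dotNl u v : dot (- u) v = - dot u v.
Proof. by rewrite !(dotC _ v) dotNr. Qed.

Lemma dotBl u1 u2 v : dot (u1 - u2) v = dot u1 v - dot u2 v.
Proof. by rewrite dotDl dotNl. Qed.

Lemma dot_ge0 v : 0 <= dot v v.
Proof. by apply: sumr_ge0 => i _; rewrite -expr2 sqr_ge0. Qed.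

Lemma dot_eq0 v : dot v v = 0 -> v = 0.
Proof.
move=> /eqP; rewrite psumr_eq0 => [/allP v0|i _]; last by rewrite -expr2 sqr_ge0.
apply/matrixP => i j; rewrite (ord1 j) mxE.
by have := v0 i (mem_index_enum _); rewrite mulf_eq0 orbb => /eqP.
Qed.

Lemma dotE u v : u^T *m v = (dot u v)%:M.
Proof.
apply/matrixP => i j; rewrite !ord1 !mxE mulr1n.
by apply: eq_bigr => k _; rewrite mxE.
Qed.

Lemma refl_mulE a v : refl a *m v = v - (2 / dot a a * dot a v) *: a.
Proof.
rewrite /refl mulmxBl mul1mx -scalemxAl -mulmxA dotE mul_mx_scalar scalerA.
by [].
Qed.

Lemma tr_refl a : (refl a)^T = refl a.
Proof. by rewrite /refl linearB /= trmx1 linearZ /= trmx_mul trmxK. Qed.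

Lemma refl_self a : refl a *m a = - a.
Proof.
rewrite refl_mulE; have [/dot_eq0 ->|a0] := eqVneq (dot a a) 0.
  by rewrite scaler0 subr0 oppr0.
by rewrite divfK // scaler_nat mulr2n opprD addrA subrr add0r.
Qed.

Lemma mulmx_eq (g h : M) : (forall v, g *m v = h *m v) -> g = h.
Proof. by move=> e; apply/trmx_inj/row_matrixP => i; rewrite -!tr_col !colE e. Qed.

Lemma refl_involutive a : refl a *m refl a = 1%:M.
Proof.
apply: mulmx_eq => v; rewrite -mulmxA mul1mx (refl_mulE a v) mulmxBr -scalemxAr.
by rewrite refl_self scalerN opprK refl_mulE subrK.
Qed.

Lemma reflN a : refl (- a) = refl a.
Proof.
by rewrite /refl dotNl dotNr opprK linearN /= mulmxN mulNmx opprK.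
Qed.

(** * Orthogonal matrices and groups generated by reflections *)

Definition orthogonal_mx g := g^T *m g = 1%:M.

Lemma orthogonal_mxC g : orthogonal_mx g -> g *m g^T = 1%:M.
Proof. exact: mulmx1C. Qed.

Lemma dot_orthogonal g u v : orthogonal_mx g -> dot (g *m u) (g *m v) = dot u v.
Proof.
move=> og; have /matrixP/(_ 0 0) := dotE (g *m u) (g *m v).
by rewrite trmx_mul mulmxA -(mulmxA _ g^T) og mulmx1 dotE !mxE !mulr1n.
Qed.

Lemma orthogonal_refl a : orthogonal_mx (refl a).
Proof. by rewrite /orthogonal_mx tr_refl refl_involutive. Qed.

Lemma orthogonal_mul g w :
  orthogonal_mx g -> orthogonal_mx w -> orthogonal_mx (g *m w).
Proof.
by move=> og ow; rewrite /orthogonal_mx trmx_mul mulmxA -(mulmxA _ g^T) og mulmx1.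
Qed.

Lemma refl_conj g a : orthogonal_mx g -> refl (g *m a) = g *m refl a *m g^T.
Proof.
move=> og; rewrite /refl dot_orthogonal // mulmxBr mulmx1 mulmxBl.
by rewrite orthogonal_mxC // -scalemxAr -scalemxAl trmx_mul !mulmxA.
Qed.

Lemma refl_prod_nil : refl_prod [::] = 1%:M :> M.
Proof. by rewrite /refl_prod big_nil. Qed.

Lemma refl_prod_cons a s : refl_prod (a :: s) = refl a *m refl_prod s.
Proof. by rewrite /refl_prod big_cons. Qed.

Lemma refl_prod_cat s1 s2 :
  refl_prod (s1 ++ s2) = refl_prod s1 *m refl_prod s2.
Proof.
elim: s1 => [|a s IH]; first by rewrite refl_prod_nil mul1mx.
by rewrite cat_cons !refl_prod_cons IH mulmxA.
Qed.

Lemma refl_prod_rev s : refl_prod (rev s) *m refl_prod s = 1%:M.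
Proof.
elim: s => [|a s IH]; first by rewrite refl_prod_nil mulmx1.
rewrite rev_cons -cats1 refl_prod_cat !refl_prod_cons refl_prod_nil mulmx1.
by rewrite -mulmxA (mulmxA (refl a)) refl_involutive mul1mx.
Qed.

Lemma refl_group1 X : refl_group X 1%:M.
Proof. by exists [::]; rewrite ?refl_prod_nil. Qed.

Lemma refl_group_refl X a : X a -> refl_group X (refl a).
Proof.
move=> Xa; exists [:: a]; last by rewrite refl_prod_cons refl_prod_nil mulmx1.
by move=> x; rewrite inE => /eqP ->.
Qed.

Lemma refl_group_mul X g w :
  refl_group X g -> refl_group X w -> refl_group X (g *m w).
Proof.
move=> [s sX ->] [t tX ->]; exists (s ++ t); last by rewrite refl_prod_cat.
by move=> x; rewrite mem_cat => /orP[/sX|/tX].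
Qed.

Lemma refl_group_sub X Y g :
  (forall a, X a -> refl_group Y (refl a)) -> refl_group X g -> refl_group Y g.
Proof.
move=> XY [s sX ->]; elim: s sX => [|a s IH] sX.
  by rewrite refl_prod_nil; exact: refl_group1.
rewrite refl_prod_cons; apply: refl_group_mul.
  by apply/XY/sX; rewrite mem_head.
by apply: IH => x xs; apply: sX; rewrite inE xs orbT.
Qed.

Lemma refl_group_orthogonal X g : refl_group X g -> orthogonal_mx g.
Proof.
move=> [s _ ->]; elim: s => [|a s IH].
  by rewrite refl_prod_nil /orthogonal_mx trmx1 mulmx1.
by rewrite refl_prod_cons; apply: orthogonal_mul => //; exact: orthogonal_refl.
Qed.

(** Reversing a word of reflections inverts its product, and the inverse of an orthogonal matrix is
    its transpose. *)
Lemma refl_group_tr X g : refl_group X g -> refl_group X g^T.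
Proof.
move=> Xg; have og := orthogonal_mxC (refl_group_orthogonal Xg).
move: Xg og => [s sX ->] og; exists (rev s); first by move=> x; rewrite mem_rev => /sX.
by rewrite -[RHS]mulmx1 -og mulmxA refl_prod_rev mul1mx.
Qed.

(** * Subspaces, linear spans and nonnegative integral spans *)

Definition subspace X :=
  [/\ X 0, forall u v, X u -> X v -> X (u + v) & forall c v, X v -> X (c *: v)].

Lemma subspaceN X v : subspace X -> X v -> X (- v).
Proof. by move=> [_ _ XZ] Xv; rewrite -scaleN1r; exact: XZ. Qed.

Lemma subspaceB X u v : subspace X -> X u -> X v -> X (u - v).
Proof. by move=> sX Xu Xv; case: (sX) => _ XD _; apply: XD => //; exact: subspaceN. Qed.

Lemma subspace_sum X s : subspace X -> (forall x, x \in s -> X x) ->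
  X (\sum_(x <- s) x).
Proof.
move=> [X0 XD _] sX; rewrite big_seq; elim/big_ind: _ => //.
Qed.

Lemma subspaceT : subspace setT. Proof. by []. Qed.

Lemma subspaceI X Y : subspace X -> subspace Y -> subspace (X `&` Y).
Proof.
move=> [X0 XD XZ] [Y0 YD YZ]; split => //.
  by move=> u v [Xu Yu] [Xv Yv]; split; [exact: XD|exact: YD].
by move=> c v [Xv Yv]; split; [exact: XZ|exact: YZ].
Qed.

Lemma sub_linspan X : X `<=` linspan X.
Proof.
move=> x Xx; exists [:: x]; first by move=> y; rewrite inE => /eqP ->.
by rewrite memv_span1.
Qed.

Lemma subspace_linspan X : subspace (linspan X).
Proof.
split; first by exists [::] => //; rewrite mem0v.
  move=> u v [s sX us] [t tX vt]; exists (s ++ t).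
    by move=> x; rewrite mem_cat => /orP[/sX|/tX].
  by rewrite span_cat memv_add.
by move=> c v [s sX vs]; exists s => //; rewrite memvZ.
Qed.

Lemma linspan_sub X U : subspace U -> X `<=` U -> linspan X `<=` U.
Proof.
move=> sU XU v [s sX]; rewrite -[s]/(tval (in_tuple s)) => /coord_span ->.
case: sU => U0 UD UZ; elim/big_ind: _ => // i _.
by apply/UZ/XU/sX/mem_nth.
Qed.

Lemma sub_natspan X : X `<=` natspan X.
Proof.
by move=> x Xx; exists [:: x]; rewrite ?big_seq1 // => y; rewrite inE => /eqP ->.
Qed.

Lemma natspanD X u v : natspan X u -> natspan X v -> natspan X (u + v).
Proof.
move=> [s sX ->] [t tX ->]; exists (s ++ t); rewrite ?big_cat //.
by move=> x; rewrite mem_cat => /orP[/sX|/tX].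
Qed.

Lemma natspan_sub X U : subspace U -> X `<=` U -> natspan X `<=` U.
Proof. by move=> sU XU _ [s sX ->]; apply: subspace_sum => // x /sX /XU. Qed.

End Euclidean.

(** * The root system of type B *)

Section RootsB.
Variables (R : realFieldType) (n : nat).
Local Notation V := 'cV[R]_n.
Local Notation M := 'M[R]_n.
Local Notation B := (rootsB R n).
Local Notation e := (@basis_vec R n).
Implicit Types (u v a b r : V) (g w : M) (s : seq V) (i j k m : 'I_n).

Lemma basis_vecE i j (z : 'I_1) : e i j z = (j == i)%:R.
Proof. by rewrite mxE (ord1 z) eqxx andbT. Qed.

Lemma dot_basis u i : dot u (e i) = u i 0.
Proof.
rewrite /dot (bigD1 i) //= basis_vecE eqxx mulr1 big1 ?addr0 // => j ji.
by rewrite basis_vecE (negPf ji) mulr0.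
Qed.

Lemma dot_basis2 i j : dot (e i) (e j) = (j == i)%:R.
Proof. by rewrite dot_basis basis_vecE. Qed.

Lemma mul_basis_eq g w : (forall i, g *m e i = w *m e i) -> g = w.
Proof. by move=> gw; apply/trmx_inj/row_matrixP => i; rewrite -!tr_col !colE gw. Qed.

Lemma sign_sqr (c : bool) : (-1) ^+ c * (-1) ^+ c = 1 :> R.
Proof. by rewrite -expr2 sqrr_sign. Qed.

(* [rho] and [omega m] are the sum of the fundamental coweights and the
   fundamental coweights themselves. *)
Definition rho : V := \col_i (i.+1)%:R.
Definition omega (m : 'I_n) : V := \col_i (m <= i)%:R.

Lemma rho_basis i : dot rho (e i) = i.+1%:R.
Proof. by rewrite dot_basis mxE. Qed.

Lemma omega_basis m i : dot (omega m) (e i) = (m <= i)%:R.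
Proof. by rewrite dot_basis mxE. Qed.

(** One index covers both kinds of simple roots: for [m = 0] the second indicator vanishes and [e m]
    remains, otherwise this is [e m] minus its predecessor. The indexing is dual to [omega]. *)
Definition simple_root m : V :=
  \col_i ((i == m)%:R - (i.+1 == m :> nat)%:R).

Lemma simple_root0 m : m = 0%N :> nat -> simple_root m = e m.
Proof.
by move=> m0; apply/matrixP => i z; rewrite !mxE (ord1 z) eqxx andbT m0 subr0.
Qed.

Lemma simple_rootS m j : m = j.+1 :> nat -> simple_root m = - e j + e m.
Proof.
move=> mj; apply/matrixP => i z.
by rewrite !mxE (ord1 z) eqxx !andbT mj eqSS addrC.
Qed.

Lemma simple_rootP v : simple B v <-> exists m, v = simple_root m.
Proof.
split=> [[[i [i0 ->]]|[i [j [ji ->]]]]|[m ->]].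
- by exists i; rewrite simple_root0.
- by exists j; rewrite (simple_rootS ji).
- case m0: (m : nat) => [|k]; first by left; exists m; rewrite simple_root0.
  have kn : (k < n)%N by rewrite ltnW // -m0.
  by right; exists (Ordinal kn), m; split => //; rewrite (@simple_rootS m (Ordinal kn)).
Qed.

Lemma rho_simple_root m : dot rho (simple_root m) = 1.
Proof.
case m0: (m : nat) => [|k]; first by rewrite simple_root0 // rho_basis m0.
have kn : (k < n)%N by rewrite ltnW // -m0.
rewrite (@simple_rootS m (Ordinal kn)) // dotDr dotNr !rho_basis m0 /=; lra.
Qed.

Lemma omega_simple_root m k : dot (omega m) (simple_root k) = (m == k)%:R.
Proof.
case k0: (k : nat) => [|l].
  by rewrite simple_root0 // omega_basis k0 leqn0 -val_eqE /= k0.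
have ln : (l < n)%N by rewrite ltnW // -k0.
rewrite (@simple_rootS k (Ordinal ln)) // dotDr dotNr !omega_basis k0 /=.
rewrite -val_eqE /= k0 (leq_eqVlt m l.+1) ltnS.
by case: eqP => [->|_]; rewrite ?ltnn ?oppr0 ?add0r // addNr.
Qed.

(** Pairing with [omega m] gives the sum of the coordinates from [m] on; two consecutive tail sums
    differ by one coordinate. *)
Lemma omega_eq0 v : (forall m, dot (omega m) v = 0) -> v = 0.
Proof.
move=> v0; apply/matrixP => i z; rewrite (ord1 z) mxE.
have oE j : dot (omega j) v = \sum_(k < n | (j <= k)%N) v k 0.
  rewrite big_mkcond; apply: eq_bigr => k _; rewrite mxE.
  by case: ifP; rewrite ?mul1r ?mul0r.
have := v0 i; rewrite oE (bigD1 i) //= => <-.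
rewrite [X in _ + X](_ : _ = 0) ?addr0 //.
have [ni|ni] := ltnP i.+1 n; last first.
  rewrite big_pred0 // => k; apply/negbTE; rewrite -val_eqE /=.
  by have := ltn_ord k; lia.
rewrite -[RHS](v0 (Ordinal ni)) oE; apply: eq_bigl => k /=.
by rewrite -val_eqE /= [RHS]ltn_neqAle eq_sym andbC.
Qed.

Lemma roots_letter i (c : bool) : roots B ((-1) ^+ c *: e i).
Proof. by left; exists i, c. Qed.

Lemma roots_basis i : roots B (e i).
Proof. by left; exists i, false; rewrite scale1r. Qed.

Lemma roots_pair i j (b c : bool) : i != j ->
  roots B ((-1) ^+ b *: e i + (-1) ^+ c *: e j).
Proof.
move=> ij; right; have [lij|lji|/val_inj eij] := ltngtP i j.
- by exists i, j, b, c.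
- by exists j, i, c, b; rewrite addrC.
- by rewrite eij eqxx in ij.
Qed.

Lemma roots_add i j : i != j -> roots B (e i + e j).
Proof. by move=> /(roots_pair false false); rewrite !scale1r. Qed.

Lemma roots_sub i j : i != j -> roots B (e j - e i).
Proof.
by rewrite eq_sym => /(roots_pair false true); rewrite scale1r expr1 scaleN1r.
Qed.

(** * Roots as short integral vectors, and their signs *)

Definition integral v := forall i, exists z : int, v i 0 = z%:~R.

Lemma integral_basis i : integral (e i).
Proof. by move=> j; exists (j == i)%:R; rewrite basis_vecE pmulrn natz. Qed.

Lemma integralD u v : integral u -> integral v -> integral (u + v).
Proof.
move=> iu iv i; have [[x xE] [y yE]] := (iu i, iv i).
by exists (x + y); rewrite mxE xE yE intrD.
Qed.

Lemma integralZ (z : int) v : integral v -> integral (z%:~R *: v).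
Proof. by move=> iv i; have [x xE] := iv i; exists (z * x); rewrite mxE xE intrM. Qed.

Lemma integralN v : integral v -> integral (- v).
Proof. by move=> /(integralZ (-1)); rewrite scaleN1r. Qed.

Lemma integral_dot u v : integral u -> integral v ->
  exists z : int, dot u v = z%:~R.
Proof.
move=> iu iv; rewrite /dot; elim/big_ind: _ => [|_ _ [x ->] [y ->]|i _].
- by exists 0.
- by exists (x + y); rewrite intrD.
- have [[x ->] [y ->]] := (iu i, iv i).
  by exists (x * y); rewrite intrM.
Qed.

(* An integral vector of squared norm less than 4 has all its coordinates in
   {-1, 0, 1}; this splits off a nonzero one. *)
Lemma integral_split v : integral v -> v != 0 -> dot v v < 4 ->
  exists i (c : bool), exists2 v' : V, v = (-1) ^+ c *: e i + v' &
    [/\ integral v', v' i 0 = 0 & dot v' v' = dot v v - 1].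
Proof.
move=> iv v0 v4.
have [i vi0] : exists i, v i 0 != 0.
  apply/existsP; apply: contraNT v0 => /existsPn v0; apply/eqP/matrixP => i z.
  by rewrite (ord1 z) mxE; apply/eqP; have := v0 i; rewrite negbK.
have vi4 : v i 0 ^+ 2 < 4.
  apply: le_lt_trans v4; rewrite /dot (bigD1 i) //= -expr2 lerDl.
  by apply: sumr_ge0 => j _; rewrite -expr2 sqr_ge0.
have [z zE] := iv i.
have [c cE] : exists c : bool, v i 0 = (-1) ^+ c.
  move: vi0 vi4; rewrite zE -rmorphXn /= intr_eq0 (_ : 4 = (4%:Z)%:~R) // ltr_int => z0 z4.
  have : z = 1 \/ z = -1 by nia.
  by case=> ->; [exists false|exists true].
exists i, c, (v - (-1) ^+ c *: e i); first by rewrite addrC subrK.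
split.
- apply: integralD => //; apply: integralN.
  have -> : (-1) ^+ c = ((-1) ^+ c : int)%:~R :> R by rewrite rmorph_sign.
  by apply: integralZ; exact: integral_basis.
- by rewrite !mxE !eqxx mulr1 cE subrr.
- rewrite !(dotBr, dotBl) !dotZr !dotZl (dotC (e i)) !dot_basis.
  by rewrite basis_vecE eqxx cE mulr1 sign_sqr; ring.
Qed.

(** Splitting off a coordinate [1] or [-1] lowers the squared norm by one, so at most two such steps
    exhaust the vector. In this form closure under isometries preserving integrality is
    immediate. *)
Lemma rootsP r : roots B r <-> integral r /\ (dot r r = 1 \/ dot r r = 2).
Proof.
have isg i (c : bool) : integral ((-1) ^+ c *: e i).
  have -> : (-1) ^+ c = ((-1) ^+ c : int)%:~R :> R by rewrite rmorph_sign.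
  by apply: integralZ; exact: integral_basis.
split=> [[[i [c ->]]|[i [j [b [c [ij ->]]]]]]|[ir rr]].
- split; first exact: isg.
  by left; rewrite dotZr dotZl dot_basis2 eqxx mulr1 sign_sqr.
- split; first exact: integralD.
  right; rewrite !(dotDr, dotDl, dotZr, dotZl) !dot_basis2 !eqxx.
  by rewrite -!val_eqE /= (gtn_eqF ij) (ltn_eqF ij) !mulr0 !mulr1 !sign_sqr; ring.
have r0 : r != 0.
  apply/eqP => r0; move: rr; rewrite r0 dot0r => -[] /esym/eqP;
  by rewrite ?oner_eq0 ?pnatr_eq0.
have r4 : dot r r < 4 by case: rr => ->; lra.
have [i [c [v rE [iv vi0 vv]]]] := integral_split ir r0 r4.
have [v0|v0] := eqVneq v 0; first by rewrite rE v0 addr0; exact: roots_letter.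
have v4 : dot v v < 4 by lra.
have [j [d [v' vE [iv' vj0 vv']]]] := integral_split iv v0 v4.
have ij : i != j.
  apply/eqP => ij; move: vi0; rewrite vE ij !mxE !eqxx mulr1 vj0 addr0.
  by apply/eqP; rewrite signr_eq0.
have : dot v' v' = 0.
  by apply/eqP; rewrite eq_le dot_ge0 vv' vv andbT; case: rr => ->; lra.
by move=> /dot_eq0 v'0; rewrite rE vE v'0 addr0; exact: roots_pair.
Qed.

Lemma roots_neq0 r : roots B r -> r != 0.
Proof.
move=> /rootsP[_ rr]; apply/eqP => r0; move: rr; rewrite r0 dot0r.
by move=> -[] /esym/eqP; rewrite ?oner_eq0 ?pnatr_eq0.
Qed.

Lemma dot_roots_gt0 r : roots B r -> 0 < dot r r.
Proof. by move=> /rootsP[_ [->|->]]; lra. Qed.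

Lemma rootsN r : roots B r -> roots B (- r).
Proof.
by move=> /rootsP[ir rr]; apply/rootsP; rewrite dotNl dotNr opprK; split => //; exact: integralN.
Qed.

(** A reflection keeps the norm, and the coefficient of [a] is an integer because [dot a a] is 1 or
    2. *)
Lemma roots_refl a r : roots B a -> roots B r -> roots B (refl a *m r).
Proof.
move=> /rootsP[ia aa] /rootsP[ir rr]; apply/rootsP.
rewrite dot_orthogonal; last exact: orthogonal_refl.
split=> //; rewrite refl_mulE; apply: integralD => //; apply: integralN.
have [z zE] := integral_dot ia ir; rewrite zE.
case: aa => ->; last by rewrite divff ?mul1r ?pnatr_eq0 //; exact: integralZ.
have -> : 2 / 1 * z%:~R = (2 * z)%:~R :> R by rewrite intrM divr1.
exact: integralZ.
Qed.

Lemma rho_roots_neq0 r : roots B r -> dot rho r != 0.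
Proof.
case=> [[i [c ->]]|[i [j [b [c [ij ->]]]]]].
  by rewrite dotZr rho_basis mulf_neq0 ?signr_eq0 ?pnatr_eq0.
have {}ij : i.+1%:R < j.+1%:R :> R by rewrite ltr_nat.
have : 0 < i.+1%:R :> R by rewrite ltr0n.
rewrite dotDr !dotZr !rho_basis => i0; apply/eqP.
by case: b; case: c; rewrite ?expr0 ?expr1; lra.
Qed.

(** The coordinates of [rho] are positive and increasing, so the coefficient at the larger index
    decides the sign. From here on positivity is a sign condition. *)
Lemma posP r : pos B r <-> roots B r /\ 0 < dot rho r.
Proof.
split=> [[[i [j [b [ij ->]]]]|[i ->]]|[]].
- split; first by right; exists i, j, b, false; rewrite scale1r.
  have {}ij : i.+1%:R < j.+1%:R :> R by rewrite ltr_nat.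
  have : 0 < i.+1%:R :> R by rewrite ltr0n.
  by rewrite dotDr dotZr !rho_basis => i0; case: b; rewrite ?expr0 ?expr1; lra.
- by split; [exact: roots_basis|rewrite rho_basis ltr0n].
- case=> [[i [[] ->]]|[i [j [b [c [ij ->]]]]]].
  + by rewrite dotZr rho_basis expr1 mulN1r oppr_gt0 ltrn0.
  + by rewrite expr0 scale1r => _; right; exists i.
  + case: c; last by move=> _; left; exists i, j, b; rewrite expr0 scale1r.
    have {}ij : i.+1%:R < j.+1%:R :> R by rewrite ltr_nat.
    have : 0 < i.+1%:R :> R by rewrite ltr0n.
    by rewrite dotDr !dotZr !rho_basis => i0; case: b; rewrite ?expr0 ?expr1; lra.
Qed.

Lemma roots_cases r : roots B r -> pos B r \/ pos B (- r).
Proof.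
move=> Br; have := rho_roots_neq0 Br; rewrite neq_lt => /orP[r0|r0]; last first.
  by left; apply/posP.
by right; apply/posP; rewrite dotNr oppr_gt0; split => //; exact: rootsN.
Qed.

Lemma pos_basis i : pos B (e i). Proof. by right; exists i. Qed.

Lemma pos_add i j : (i < j)%N -> pos B (e i + e j).
Proof. by move=> ij; left; exists i, j, false; rewrite scale1r. Qed.

Lemma pos_sub i j : (i < j)%N -> pos B (e j - e i).
Proof. by move=> ij; left; exists i, j, true; rewrite scaleN1r addrC. Qed.

Lemma pos_simple a : simple B a -> pos B a.
Proof.
case=> [[i [_ ->]]|[i [j [ij ->]]]]; first exact: pos_basis.
by rewrite addrC; apply: pos_sub; rewrite ij.
Qed.

Lemma roots_simple a : simple B a -> roots B a.
Proof. by move=> /pos_simple/posP[]. Qed.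

(** The difference telescopes into the simple roots with index in [i+1..j]; keeping [X] arbitrary
    records that no other simple root occurs. *)
Lemma natspan_sub_basis (X : set V) i j : (i < j)%N ->
  (forall m, (i < m <= j)%N -> X (simple_root m)) -> natspan X (e j - e i).
Proof.
case: j => j jn /=; elim: j jn => // j IH jn ij Xm.
have jn' := ltnW jn.
rewrite (_ : _ - _ = e (Ordinal jn') - e i + simple_root (Ordinal jn)); last first.
  by rewrite (@simple_rootS _ (Ordinal jn')) // addrACA subrr add0r addrC.
have Xj : natspan X (simple_root (Ordinal jn)).
  by apply/sub_natspan/Xm; rewrite ij /=.
have [ij'|ji] := ltnP i j; last first.
  by rewrite (_ : i = Ordinal jn') ?subrr ?add0r //; apply/val_inj => /=; lia.
apply: natspanD => //; apply: IH => // m /andP[im mj].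
by apply: Xm; rewrite im ltnW.
Qed.

Lemma natspan_basis (X : set V) i :
  (forall m, (m <= i)%N -> X (simple_root m)) -> natspan X (e i).
Proof.
move=> Xm; have n0 : (0 < n)%N by case: i {Xm} => [[|i]] //; exact: ltn_trans.
have N0 : natspan X (e (Ordinal n0)).
  by rewrite -simple_root0 //; exact/sub_natspan/Xm.
have [i0|i0] := posnP i; first by rewrite (_ : i = Ordinal n0) //; apply/val_inj.
rewrite -[e i](subrK (e (Ordinal n0))); apply: natspanD => //.
by apply: natspan_sub_basis => // m /andP[_ /Xm].
Qed.

Lemma natspan_pos r : pos B r -> natspan (simple B) r.
Proof.
have sB m : simple B (simple_root m) by apply/simple_rootP; exists m.
case=> [[i [j [[] [ij ->]]]]|[i ->]].
- by rewrite scaleN1r addrC; exact: natspan_sub_basis.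
- by rewrite scale1r; apply: natspanD; exact: natspan_basis.
- exact: natspan_basis.
Qed.

End RootsB.

(** * The Weyl group and restrictions *)

Section WeylB.
Variables (R : realFieldType) (n : nat).
Local Notation V := 'cV[R]_n.
Local Notation M := 'M[R]_n.
Local Notation B := (rootsB R n).
Local Notation e := (@basis_vec R n).
Local Notation rho := (@rho R n).
Local Notation omega := (@omega R n).
Local Notation simple_root := (@simple_root R n).
Implicit Types (u v a b r : V) (g w : M) (s : seq V) (i j k m : 'I_n) (U : set V).

Lemma rho_sum s : (forall x, x \in s -> simple B x) ->
  dot rho (\sum_(x <- s) x) = (size s)%:R.
Proof.
elim: s => [|a s IH] sB; first by rewrite big_nil dot0r.
rewrite big_cons dotDr IH => [|x xs]; last by apply: sB; rewrite inE xs orbT.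
have /simple_rootP[m ->] := sB a (mem_head _ _).
by rewrite rho_simple_root /= -natr1 addrC.
Qed.

Lemma omega_sum s m : (forall x, x \in s -> simple B x) ->
  dot (omega m) (\sum_(x <- s) x) = (count_mem (simple_root m) s)%:R.
Proof.
elim: s => [|a s IH] sB; first by rewrite big_nil dot0r.
rewrite big_cons dotDr IH => [|x xs]; last by apply: sB; rewrite inE xs orbT.
have /simple_rootP[k ->] := sB a (mem_head _ _).
rewrite omega_simple_root /= natrD; congr (_%:R + _).
case: eqVneq => [->|mk]; first by rewrite eqxx.
case: eqP => // /(congr1 (dot (omega m)))/eqP.
by rewrite !omega_simple_root eqxx (negPf mk) eq_sym oner_eq0.
Qed.

Lemma omega_pos_ge0 m r : pos B r -> 0 <= dot (omega m) r.
Proof. by move=> /natspan_pos[s sB ->]; rewrite omega_sum // ler0n. Qed.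

(** The coordinates of a root in the simple roots never have opposite signs, so a single positive
    one makes the root positive. *)
Lemma omega_roots_gt0 m r : roots B r -> 0 < dot (omega m) r -> 0 < dot rho r.
Proof.
move=> Br mr; have [/posP[]//|/(omega_pos_ge0 m)] := roots_cases Br.
by rewrite dotNr oppr_ge0 leNgt mr.
Qed.

(** Otherwise [r] would be a natural multiple of [simple_root k]; as squared norms of roots are 1 or
    2, the factor would be 1. *)
Lemma pos_support r k : pos B r -> r != simple_root k ->
  exists2 m, m != k & 0 < dot (omega m) r.
Proof.
move=> pr rk; apply: contrapT => no.
have no' m : m != k -> dot (omega m) r = 0.
  move=> mk; apply/eqP; rewrite eq_le omega_pos_ge0 // andbT leNgt.
  by apply/negP => mr; apply: no; exists m.
have [z rE] : exists z : nat, r = z%:R *: simple_root k.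
  have [s sB rE] := natspan_pos pr; exists (count_mem (simple_root k) s).
  apply/eqP; rewrite -subr_eq0; apply/eqP/omega_eq0 => m.
  rewrite dotBr dotZr omega_simple_root.
  have [->|mk] := eqVneq m k; last by rewrite no' // mulr0 subr0.
  by rewrite mulr1 {1}rE omega_sum // subrr.
have /posP[/rootsP[_ rr] _] := pr.
have /roots_simple/rootsP[_ kk] : simple B (simple_root k) by apply/simple_rootP; exists k.
have : z = 1%N.
  move: rr; rewrite rE dotZr dotZl; case: kk => ->; rewrite ?mulr1 -?natrM.
    move=> [] /eqP; rewrite ?eqr_nat ?pnatr_eq1 => /eqP; lia.
  move=> [] /eqP; rewrite ?eqr_nat ?pnatr_eq1 => /eqP; lia.
by move=> z1; move: rk; rewrite rE z1 scale1r eqxx.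
Qed.

(** The reflection changes only the coordinate at [a], and [r] has another positive coordinate,
    which survives. *)
Lemma simple_refl_pos a r : simple B a -> pos B r -> r != a ->
  pos B (refl a *m r).
Proof.
move=> /[dup] /roots_simple Ba /simple_rootP[k aE] /[dup] /posP[Br _] pr.
rewrite {1}aE => /(pos_support pr)[m mk mr].
apply/posP; split; first exact: roots_refl.
apply: (@omega_roots_gt0 m); first exact: roots_refl.
by rewrite refl_mulE dotBr dotZr aE omega_simple_root (negPf mk) mulr0 subr0.
Qed.

Lemma rho_simple_refl a r : simple B a -> roots B r -> r != a -> r != - a ->
  (0 < dot rho (refl a *m r)) = (0 < dot rho r).
Proof.
move=> sa Br ra rNa; have [pr|pr] := roots_cases Br.
  have /posP[_ ->] := simple_refl_pos sa pr ra.
  by have /posP[_ ->] := pr.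
have rNa' : - r != a by rewrite eqr_oppLR.
have /posP[_] := simple_refl_pos sa pr rNa'.
have /posP[_] := pr; rewrite mulmxN !dotNr !oppr_gt0 => r1 r2.
by rewrite !ltNge !ltW.
Qed.

(** Induction on the number of simple roots that sum to a positive [r]: a simple [a] with
    [0 < dot a r] makes [refl a *m r] a shorter sum, and [refl r] is the conjugate by [refl a] of
    its reflection. *)
Lemma refl_simple_group r : roots B r -> refl_group (simple B) (refl r).
Proof.
move=> Br; wlog pr : r Br / pos B r.
  move=> gen; have [/gen|] := roots_cases Br; first exact.
  by move=> /[dup]/posP[BN _] /gen; rewrite reflN; apply.
have [s sB rE] := natspan_pos pr.
have [N sN] := ubnP (size s); elim: N => // N IH in r s sB rE sN Br pr *.
have [|nr] := pselect (simple B r); first exact: refl_group_refl.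
(* If every simple root had nonpositive product with [r], summing over the decomposition of [r]
   would give [dot r r <= 0]. *)
have [a sa ar] : exists2 a, simple B a & 0 < dot a r.
  apply: contrapT => no; have := dot_roots_gt0 Br.
  rewrite {2}rE dot_sumr big_seq ltNge sumr_le0 // => x /sB sx.
  by rewrite leNgt dotC; apply/negP => xr; apply: no; exists x.
have ra : r != a by apply/eqP => ra; rewrite ra in nr.
have pr' := simple_refl_pos sa pr ra.
have /posP[Br' _] := pr'.
have [t tB tE] := natspan_pos pr'.
have aa := dot_roots_gt0 (roots_simple sa).
have ts : (size t < size s)%N.
  have ra1 : dot rho a = 1 by have /simple_rootP[k ->] := sa; rewrite rho_simple_root.
  rewrite -(ltr_nat R) -!rho_sum // -tE -rE refl_mulE dotBr dotZr ra1.
  rewrite mulr1 ltrBlDr ltrDl.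
  by rewrite !mulr_gt0 ?invr_gt0.
have Ra := IH _ t tB tE (leq_trans ts sN) Br' pr'.
rewrite (_ : refl r = refl a *m refl (refl a *m r) *m refl a).
  by do 2?apply: refl_group_mul; rewrite //; apply: refl_group_refl.
rewrite refl_conj; last exact: orthogonal_refl.
rewrite tr_refl !mulmxA refl_involutive mul1mx -mulmxA refl_involutive.
by rewrite mulmx1.
Qed.

Lemma weyl_simple_group w : weyl B w -> refl_group (simple B) w.
Proof. exact: refl_group_sub refl_simple_group. Qed.

Lemma weyl_roots w r : weyl B w -> roots B r -> roots B (w *m r).
Proof.
move=> [s sB ->] Br; elim: s sB => [|a s IH] sB.
  by rewrite refl_prod_nil mul1mx.
rewrite refl_prod_cons -mulmxA; apply: roots_refl; first exact/sB/mem_head.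
by apply: IH => x xs; apply: sB; rewrite inE xs orbT.
Qed.

Lemma roots_norm1 r : roots B r -> dot r r = 1 ->
  exists i (c : bool), r = (-1) ^+ c *: e i.
Proof.
case=> [?|[i [j [b [c [ij ->]]]]]]; first by [].
rewrite !(dotDr, dotDl, dotZr, dotZl) !dot_basis2 !eqxx.
rewrite -!val_eqE /= (gtn_eqF ij) (ltn_eqF ij) !mulr0 !mulr1 !sign_sqr.
by move=> e11; lra.
Qed.

(** Induction on the number of basis vectors moved by [g]: a root reflection sends [g *m e i] back
    to [e i] without disturbing the basis vectors already fixed. *)
Lemma orthogonal_weyl g : orthogonal_mx g -> (forall i, roots B (g *m e i)) ->
  weyl B g.
Proof.
have [N] := ubnP #|[pred i | g *m e i != e i]|; elim: N => // N IH in g *.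
move=> gN og Bg.
have [/existsP[i gi]|] := boolP [exists i, g *m e i != e i]; last first.
  move=> /existsPn fix_g; rewrite (@mul_basis_eq _ _ g 1%:M); first exact: refl_group1.
  by move=> i; rewrite mul1mx; apply/eqP; have := fix_g i; rewrite negbK.
have gii : dot (g *m e i) (g *m e i) = 1 by rewrite dot_orthogonal // dot_basis2 eqxx.
(* The root is [e i] when [g *m e i = - e i], and [g *m e i - e i] when [g *m e i] lies on another
   axis. *)
have [a [Ba ai afix]] : exists a, [/\ roots B a, refl a *m (g *m e i) = e i &
    forall k, k != i -> g *m e k = e k -> dot a (e k) = 0].
  have [j [c gE]] := roots_norm1 (Bg i) gii.
  have [ji|ji] := eqVneq j i.
    exists (e i); split; first exact: roots_basis.
      move: gi; rewrite gE ji; case: c {gE} => [_|]; last by rewrite scale1r eqxx.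
      by rewrite expr1 scaleN1r mulmxN refl_self opprK.
    by move=> k ki _; rewrite dot_basis2 (negPf ki).
  exists (g *m e i - e i).
  have gie : dot (g *m e i) (e i) = 0.
    by rewrite gE dotZl dot_basis2 eq_sym (negPf ji) mulr0.
  split.
  - by rewrite gE -scaleN1r -(expr1 (-1)) -[X in X ^+ 1]/(-1); apply: (roots_pair _ c true).
  - rewrite refl_mulE !(dotBl, dotBr) gii gie (dotC (e i)) gie dot_basis2 eqxx.
    rewrite !subr0 sub0r opprK mulr1 (_ : 2 / (1 + 1) = 1); last by rewrite divff ?pnatr_eq0.
    by rewrite scale1r opprB addrC subrK.
  - move=> k ki gk; rewrite dotBl dot_basis2 (negPf ki) -{1}gk.
    by rewrite dot_orthogonal // dot_basis2 (negPf ki) subrr.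
have -> : g = refl a *m (refl a *m g) by rewrite mulmxA refl_involutive mul1mx.
apply: refl_group_mul; first exact: refl_group_refl.
apply: IH; last 2 first.
- by apply: orthogonal_mul => //; exact: orthogonal_refl.
- by move=> k; rewrite -mulmxA; exact: roots_refl.
apply: leq_trans (_ : _ < #|[pred i0 | g *m e i0 != e i0]|)%N _; last by rewrite -ltnS.
apply: proper_card; apply/properP; split; last by exists i; rewrite !inE // -mulmxA ai eqxx.
apply/fintype.subsetP => k; rewrite !inE; apply: contraNN => /eqP gk.
have [->|ki] := eqVneq k i; first by rewrite -mulmxA ai.
by rewrite -mulmxA gk refl_mulE afix // mulr0 scale0r subr0.
Qed.

Lemma dot_letter_vec (x y : letter n) :
  dot (letter_vec R x) (letter_vec R y) = (-1) ^+ (x.1 (+) y.1) * (x.2 == y.2)%:R.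
Proof.
by rewrite dotZl dotZr dot_basis2 mulrA signr_addb eq_sym.
Qed.

Lemma sperm_mx_basis (w : sperm n) i :
  sperm_mx R w *m e i = letter_vec R (w (false, i)).
Proof. by apply/matrixP => k z; rewrite /basis_vec -colE !mxE (ord1 z). Qed.

Lemma rho_sperm_mx (w : sperm n) i :
  dot rho (sperm_mx R w *m e i) = (letter_int (w (false, i)))%:~R.
Proof.
by rewrite sperm_mx_basis dotZr rho_basis /letter_int intrM rmorph_sign.
Qed.

(** Images with the same absolute value are equal or opposite, hence images of [j] or of its
    opposite, and [w] is injective. *)
Lemma sperm_index_inj (w : sperm n) i j :
  (w (false, i)).2 = (w (false, j)).2 -> i = j.
Proof.
move=> wij; have [b] : exists c : bool, w (false, i) = w (c, j).
  exists ((w (false, i)).1 (+) (w (false, j)).1).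
  case: (w (false, i)) wij (spermN w (false, j)) => b1 k /= ->.
  case wj: (w (false, j)) => [b2 k2]; rewrite /letter_opp /=.
  by case: b1; case: b2 wj => //= wj; rewrite ?wj // => ->.
by move/perm_inj => [].
Qed.

Lemma weyl_sperm_mx (w : sperm n) : weyl B (sperm_mx R w).
Proof.
apply: orthogonal_weyl => [|i]; last first.
  by rewrite sperm_mx_basis; exact: roots_letter.
apply/matrixP => i j; rewrite !mxE.
transitivity (dot (letter_vec R (w (false, i))) (letter_vec R (w (false, j)))).
  by apply: eq_bigr => k _; rewrite !mxE.
rewrite dot_letter_vec; case: (eqVneq i j) => [->|ij].
  by rewrite addbb eqxx mulr1.
case: eqP => [/sperm_index_inj ij'|_]; last by rewrite mulr0.
by rewrite ij' eqxx in ij.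
Qed.

Lemma subspace_refl U a r : subspace U -> U a -> U r -> U (refl a *m r).
Proof.
move=> sU Ua Ur; rewrite refl_mulE; apply: subspaceB => //.
by case: sU => _ _; apply.
Qed.

Lemma refl_group_subspace (X : set V) U w r : subspace U -> X `<=` U ->
  refl_group X w -> U r -> U (w *m r).
Proof.
move=> sU XU [s sX ->] Ur; elim: s sX => [|a s IH] sX.
  by rewrite refl_prod_nil mul1mx.
rewrite refl_prod_cons -mulmxA; apply: subspace_refl => //.
  exact/XU/sX/mem_head.
by apply: IH => x xs; apply: sX; rewrite inE xs orbT.
Qed.

Lemma weyl_restrict U w : weyl (restrict B U) w -> weyl B w.
Proof. by apply: refl_group_sub => a [Ba _]; exact: refl_group_refl. Qed.

Lemma restrict_restrict U U' :
  restrict (restrict B U) U' = restrict B (U `&` U').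
Proof. by rewrite /restrict /= !setIA. Qed.

Lemma restrictT : restrict B setT = B.
Proof. by rewrite /restrict !setIT. Qed.

Lemma rho_roots_leNgt r : roots B r -> (dot rho r < 0) = ~~ (0 < dot rho r).
Proof. by move=> /rho_roots_neq0 r0; rewrite -leNgt lt_neqAle r0. Qed.

(** For Weyl group elements this says that [w] and [w'] have the same inversions among the positive
    roots in [U], in a form free of the set [inversions]. *)
Definition agree U w w' := forall r, roots B r -> U r ->
  (0 < dot rho (w *m r)) = (0 < dot rho (w' *m r)).

(* Prepending a simple reflection [s_a] to [w] only changes the sign of [w r]
   for [r = +- w^-1 a], so it is either invisible in [U] or a reflection of
   the restriction. *)
Lemma restriction_exists U w : subspace U -> weyl B w ->
  exists2 w', weyl (restrict B U) w' & agree U w w'.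
Proof.
move=> sU /weyl_simple_group[s sB ->]; elim: s sB => [|a s IH] sB.
  by exists 1%:M; [exact: refl_group1|rewrite refl_prod_nil].
have sa : simple B a by apply: sB; rewrite mem_head.
have {}sB x : x \in s -> simple B x by move=> xs; apply: sB; rewrite inE xs orbT.
have [w' Ww' ag] := IH sB.
rewrite refl_prod_cons; set w1 := refl_prod s in ag *.
have Ww1 : weyl B w1.
  apply: refl_group_sub (_ : refl_group (simple B) w1); last by exists s.
  by move=> x /roots_simple; exact: refl_group_refl.
have ow1 := refl_group_orthogonal Ww1.
have Bc : roots B (w1^T *m a).
  by apply: weyl_roots; [exact: refl_group_tr|exact: roots_simple].
have [Uc|nUc] := pselect (U (w1^T *m a)).
  exists (w' *m refl (w1^T *m a)).
    by apply: refl_group_mul => //; exact: refl_group_refl.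
  move=> r Br Ur; rewrite -[X in _ = (_ < dot _ X)]mulmxA -ag; last 2 first.
  - exact: roots_refl.
  - exact: subspace_refl.
  rewrite refl_conj; last by rewrite /orthogonal_mx trmxK orthogonal_mxC.
  by rewrite trmxK !mulmxA orthogonal_mxC // mul1mx.
exists w' => // r Br Ur; rewrite -ag // -mulmxA rho_simple_refl //.
- exact: weyl_roots.
- apply/eqP => w1r; apply: nUc; rewrite -w1r mulmxA ow1 mul1mx //.
- apply/eqP => w1r; apply: nUc; rewrite -[a]opprK -w1r mulmxN mulmxA ow1 mul1mx.
  exact: subspaceN.
Qed.

(** An element generated by reflections in roots of [U] preserves [U], so the membership of
    [- (w *m a)] in [U] is automatic. *)
Lemma inversions_restrict U w a : subspace U -> weyl (restrict B U) w ->
  inversions (restrict B U) w a <-> [/\ pos B a, U a & dot rho (w *m a) < 0].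
Proof.
move=> sU Ww; have WwB := weyl_restrict Ww.
split=> [[[pa Ua] [/posP[_]]]|[pa Ua wa]].
  by rewrite dotNr oppr_gt0.
split=> //; have /posP[Ba _] := pa; split.
  by apply/posP; rewrite dotNr oppr_gt0; split => //; apply/rootsN/weyl_roots.
apply: subspaceN => //; apply: (refl_group_subspace sU _ Ww) => //.
by move=> ? [].
Qed.

Lemma is_restrictionP U U' w w' : subspace U -> subspace U' ->
  weyl (restrict B U) w ->
  is_restriction (restrict B U) U' w w' <->
  weyl (restrict B (U `&` U')) w' /\ agree (U `&` U') w w'.
Proof.
move=> sU sU' Ww; have sUU := subspaceI sU sU'.
rewrite /is_restriction restrict_restrict; split=> -[Ww']; last first.
  move=> ag; split => //; apply/seteqP; split => a.
    move=> /(inversions_restrict _ sUU Ww')[pa [Ua U'a] wa]; split => //.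
    apply/inversions_restrict => //; split => //.
    have /posP[Ba _] := pa.
    have Bwa : roots B (w *m a) by apply: weyl_roots => //; exact: weyl_restrict Ww.
    rewrite rho_roots_leNgt // ag // -rho_roots_leNgt //.
    by apply: weyl_roots => //; exact: weyl_restrict Ww'.
  move=> [/(inversions_restrict _ sU Ww)[pa Ua wa] U'a].
  apply/inversions_restrict => //; split => //.
  have /posP[Ba _] := pa.
  have Bwa : roots B (w' *m a) by apply: weyl_roots => //; exact: weyl_restrict Ww'.
  rewrite rho_roots_leNgt // -ag // -rho_roots_leNgt //.
  by apply: weyl_roots => //; exact: weyl_restrict Ww.
move=> inv; split => // r Br [Ur U'r].
have {}inv a : pos B a -> U a -> U' a ->
    (0 < dot rho (w *m a)) = (0 < dot rho (w' *m a)).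
  move=> /[dup] pa /posP[Ba _] Ua U'a; apply: negb_inj; rewrite -!rho_roots_leNgt.
  - apply/idP/idP => wa.
      have : (inversions (restrict B U) w `&` U') a.
        by split => //; apply/inversions_restrict.
      by rewrite -inv => /(inversions_restrict _ sUU Ww')[].
    have : inversions (restrict B (U `&` U')) w' a by apply/inversions_restrict.
    by rewrite inv => -[/(inversions_restrict _ sU Ww)[]].
  - by apply: weyl_roots => //; exact: weyl_restrict Ww'.
  - by apply: weyl_roots => //; exact: weyl_restrict Ww.
(* Inversions only test positive roots; a negative root follows by changing both signs. *)
have [pr|pr] := roots_cases Br; first exact: inv.
have := inv _ pr (subspaceN sU Ur) (subspaceN sU' U'r).
rewrite !mulmxN !dotNr !oppr_gt0 !rho_roots_leNgt.
- exact: negb_inj.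
- by apply: weyl_roots => //; exact: weyl_restrict Ww'.
- by apply: weyl_roots => //; exact: weyl_restrict Ww.
Qed.

End WeylB.

(** * Separable elements are pattern-free *)

Section Separable.
Variables (R : realFieldType) (n : nat).
Local Notation V := 'cV[R]_n.
Local Notation M := 'M[R]_n.
Local Notation B := (rootsB R n).
Local Notation e := (@basis_vec R n).
Local Notation rho := (@rho R n).
Local Notation omega := (@omega R n).
Local Notation simple_root := (@simple_root R n).
Implicit Types (u v a b r : V) (g w : M) (s : seq V) (i j k l m : 'I_n) (U : set V).

Definition height w i : R := dot rho (w *m e i).

Lemma height_sub w i j : dot rho (w *m (e j - e i)) = height w j - height w i.
Proof. by rewrite mulmxBr dotBr. Qed.

Lemma height_add w i j : dot rho (w *m (e i + e j)) = height w i + height w j.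
Proof. by rewrite mulmxDr dotDr. Qed.

(* For [w] in the Weyl group, [0 < x j] and [0 < x i + x j] differ exactly when
   [x i] and [x j] have opposite signs and [`|x j| < `|x i|]. *)
Definition mixed_inversion (x : 'I_n -> R) i j := (0 < x j) != (0 < x i + x j).

Definition crossing (x : 'I_n -> R) i j k l :=
  [/\ x j < x l, x l < x i & x i < x k] \/ [/\ x k < x i, x i < x l & x l < x j].

(** Crossings are tested through differences [e j - e i], since a type A subsystem contains these
    but no [e i]. *)
Definition pattern_free U w :=
  (forall i j, (i < j)%N -> U (e i) -> U (e j) -> ~ mixed_inversion (height w) i j) /\
  (forall i j k l, (i < j)%N -> (j < k)%N -> (k < l)%N ->
     U (e j - e i) -> U (e k - e j) -> U (e l - e k) ->
     ~ crossing (height w) i j k l).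

Lemma mixed_inversion_agree U w w' i j : subspace U -> agree U w w' -> (i < j)%N ->
  U (e i) -> U (e j) -> mixed_inversion (height w) i j -> mixed_inversion (height w') i j.
Proof.
move=> [_ UD _] ag ij Ui Uj; rewrite /mixed_inversion -!height_add.
have Bij : roots B (e i + e j) by apply: roots_add; rewrite neq_ltn ij.
by rewrite !(ag _ (roots_basis R j)) // !(ag _ Bij) //; exact: UD.
Qed.

Lemma basis_add_sub i j k : e k - e i = (e j - e i) + (e k - e j).
Proof. by rewrite [RHS]addrC addrA subrK. Qed.

Lemma crossing_agree U w w' i j k l : subspace U -> agree U w w' ->
  (i < j)%N -> (j < k)%N -> (k < l)%N ->
  U (e j - e i) -> U (e k - e j) -> U (e l - e k) ->
  crossing (height w) i j k l -> crossing (height w') i j k l.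
Proof.
move=> sU ag ij jk kl Uij Ujk Ukl.
have lt (x y : 'I_n) : x != y -> U (e y - e x) -> height w x < height w y -> height w' x < height w' y.
  move=> xy Uxy; rewrite -subr_gt0 -height_sub ag //; last exact: roots_sub.
  by rewrite height_sub subr_gt0.
have UN x y : U (e x - e y) -> U (e y - e x) by rewrite -(opprB (e x)) => /(subspaceN sU).
have UD x y : U x -> U y -> U (x + y) by case: sU => _ + _; apply.
have Uik : U (e k - e i) by rewrite (basis_add_sub i j); exact: UD.
have Ujl : U (e l - e j) by rewrite (basis_add_sub j k); exact: UD.
have Uil : U (e l - e i) by rewrite (basis_add_sub i k); exact: UD.
have [ik jl] := (ltn_trans ij jk, ltn_trans jk kl); have il := ltn_trans ik kl.
case=> -[h1 h2 h3]; [left|right]; split;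
  by apply: lt => //; rewrite ?neq_ltn ?ik ?jl ?il ?orbT //; apply: UN.
Qed.

(** Both bad configurations are read off the signs of [w] on roots of [U]: sums of two basis
    vectors, or differences, which are sums of consecutive ones. *)
Lemma pattern_free_agree U w w' : subspace U -> agree U w w' ->
  pattern_free U w' -> pattern_free U w.
Proof.
move=> sU ag [f2 f4]; split.
  by move=> i j ij Ui Uj /(mixed_inversion_agree sU ag ij Ui Uj); exact: f2.
move=> i j k l ij jk kl U1 U2 U3 /(crossing_agree sU ag ij jk kl U1 U2 U3).
exact: f4.
Qed.

Lemma pattern_free_sub U U' w : U' `<=` U -> pattern_free U w -> pattern_free U' w.
Proof.
move=> UU [f2 f4]; split; first by move=> i j ij /UU Ui /UU Uj; exact: f2.
by move=> i j k l ij jk kl /UU U1 /UU U2 /UU U3; exact: f4.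
Qed.

(** This makes [simple B] intersected with [U] a simple system of the restriction. It holds for
    spans of simple roots and passes to irreducible components, the two kinds of subspaces met in
    the recursion. *)
Definition simply_spanned U :=
  subspace U /\ pos B `&` U `<=` natspan (simple B `&` U).

Lemma simply_spannedT : simply_spanned setT.
Proof. by split; [exact: subspaceT|rewrite !setIT; exact: natspan_pos]. Qed.

Lemma linspan_dot0 (X : set V) u v :
  (forall x, X x -> dot u x = 0) -> linspan X v -> dot u v = 0.
Proof.
move=> u0; apply: (@linspan_sub _ _ X [set x | dot u x = 0]) => //; split.
- exact: dot0r.
- by move=> x y /= x0 y0; rewrite dotDr x0 y0 addr0.
- by move=> c x /= x0; rewrite dotZr x0 mulr0.
Qed.

Lemma omega_linspan (J : set V) m v : J `<=` simple B -> ~ J (simple_root m) ->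
  linspan J v -> dot (omega m) v = 0.
Proof.
move=> sJ nJ; apply: linspan_dot0 => x /[dup] Jx /sJ/simple_rootP[k xE].
rewrite xE omega_simple_root; case: eqP => // mk.
by case: nJ; rewrite mk -xE.
Qed.

Lemma simply_spanned_linspan (J : set V) :
  J `<=` simple B -> simply_spanned (linspan J).
Proof.
move=> sJ; split; first exact: subspace_linspan.
move=> r [/natspan_pos[s sB rE] Jr]; exists s => // x xs; split; first exact: sB.
apply: sub_linspan; have /simple_rootP[m xE] := sB _ xs.
rewrite xE; apply: contrapT => nJ; have := omega_linspan sJ nJ Jr.
rewrite rE omega_sum // => /eqP; rewrite pnatr_eq0 => /eqP/count_memPn.
by rewrite -xE xs.
Qed.

Lemma omega_simply_spanned U m r : simply_spanned U -> ~ U (simple_root m) ->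
  roots B r -> U r -> dot (omega m) r = 0.
Proof.
move=> [sU Us] nU; wlog pr : r / pos B r.
  move=> gen /[dup] Br /roots_cases[pr|pr] Ur; first exact: gen.
  apply/eqP; rewrite -oppr_eq0 -dotNr; apply/eqP.
  by apply: gen => //; [exact: rootsN|exact: subspaceN].
move=> _ Ur; have [s sU' ->] := Us r (conj pr Ur).
have sB x : x \in s -> simple B x by move=> /sU'[].
rewrite omega_sum //; apply/eqP; rewrite pnatr_eq0; apply/eqP/count_memPn.
by apply/negP => /sU'[].
Qed.

(** Write a root as a sum of simple roots and separate those in [X m]. The remaining part lies in
    the span of [X m] and is orthogonal to [X m], so it is zero. *)
Lemma simply_spanned_component U (k : nat) (X : 'I_k -> set V) (m : 'I_k) :
  simply_spanned U -> roots B `&` U = \bigcup_i X i ->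
  (forall c d : 'I_k, c != d -> orthogonal (X c) (X d)) ->
  simply_spanned (U `&` linspan (X m)).
Proof.
move=> [sU Us] UX Xo; split; first by apply: subspaceI => //; exact: subspace_linspan.
move=> r [pr [Ur Lr]]; have [s sU' rE] := Us r (conj pr Ur).
have sL := subspace_linspan (X m).
pose s1 := [seq x <- s | `[< X m x >]]; pose s2 := [seq x <- s | ~~ `[< X m x >]].
have rs : r = \sum_(x <- s1) x + \sum_(x <- s2) x.
  by rewrite rE !big_filter [LHS](bigID (fun x => `[< X m x >])).
have L1 : linspan (X m) (\sum_(x <- s1) x).
  apply: subspace_sum => // x; rewrite mem_filter => /andP[/asboolP Xx _].
  exact: sub_linspan.
have L2 : linspan (X m) (\sum_(x <- s2) x).
  have -> : \sum_(x <- s2) x = r - \sum_(x <- s1) x by rewrite rs [RHS]addrC addKr.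
  exact: subspaceB.
have s20 : \sum_(x <- s2) x = 0.
  apply: dot_eq0; apply: (linspan_dot0 _ L2) => x Xx.
  rewrite dotC dot_sumr big_seq big1 // => y.
  rewrite mem_filter => /andP[/asboolP nXy /sU'[/roots_simple By Uy]].
  have [j _ Xjy] : (\bigcup_i X i) y by rewrite -UX.
  have [jm|jm] := eqVneq j m; first by case: nXy; rewrite -jm.
  by rewrite dotC; apply: Xo jm _ _ _ _.
exists s1; last by rewrite rs s20 addr0.
move=> x; rewrite mem_filter => /andP[/asboolP Xx /sU'[sx Ux]].
by split => //; split => //; exact: sub_linspan.
Qed.

Lemma linspan_simple_sub U a : simply_spanned U ->
  U `&` linspan ((simple B `&` U) `\ a) = linspan ((simple B `&` U) `\ a).
Proof.
move=> [sU _]; apply/seteqP; split=> [x []//|x Lx]; split => //.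
by move: Lx; apply: linspan_sub => // y [[]].
Qed.

(** Either [a] occurs in a decomposition of [b] into simple roots, or [b] is a sum of the other
    ones. *)
Lemma root_le_or_linspan U a b : simply_spanned U -> pos B b -> U b ->
  root_le (restrict B U) a b \/ linspan ((simple B `&` U) `\ a) b.
Proof.
move=> [sU Us] pb Ub; have [s sU' bE] := Us b (conj pb Ub).
have [as_|as_] := boolP (a \in s); [left|right].
  exists (rem a s); first by move=> x /mem_rem /sU'.
  by rewrite bE (big_rem a) //= [X in X - _]addrC addrK.
rewrite bE; apply: subspace_sum; first exact: subspace_linspan.
move=> x xs; apply: sub_linspan; split; first exact: sU'.
by move=> xa; move: as_; rewrite -xa xs.
Qed.

Lemma root_leD U a b c : root_le (restrict B U) a b ->
  natspan (simple B `&` U) c -> root_le (restrict B U) a (b + c).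
Proof. by move=> ab Uc; rewrite /root_le addrAC; exact: natspanD. Qed.

(** Induction on the derivation of separability; the datum stays general, with [D = restrict B U] as
    an equation, so that the induction hypotheses apply to the smaller subspaces. *)
Lemma separable_pattern_free (D : root_datum R n) w : separable D w ->
  forall U, D = restrict B U -> simply_spanned U -> pattern_free U w.
Proof.
elim=> {D w}.
- move=> D w D0 _ U DE _; have no r : roots B r -> U r -> False.
    by move=> Br Ur; have : roots D r; [rewrite DE|rewrite D0].
  split=> [i j _ /(no _ (roots_basis R i))//|i j k l ij _ _ /no U1 _ _].
  by case: U1; apply: roots_sub; rewrite neq_ltn ij.
- move=> D w a a0 Da _ U DE _.
  (* In rank one any two roots are proportional, whereas a bad configuration supplies two that are
     not: [e i], [e j], or two consecutive differences. *)
  have eqN r r' : roots B r -> roots B r' -> U r -> U r' -> r' = r \/ r' = - r.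
    move=> Br Br' Ur Ur'.
    have : roots D r by rewrite DE.
    have : roots D r' by rewrite DE.
    by rewrite Da => -[->|->] [->|->]; rewrite ?opprK; auto.
  split=> [i j ij Ui Uj _|i j k l ij jk _ U1 U2 _ _].
    have := eqN _ _ (roots_basis R i) (roots_basis R j) Ui Uj.
    case=> /(congr1 (dot (e j))); rewrite ?dotNr !dot_basis2 eqxx -val_eqE /= (ltn_eqF ij) ?oppr0;
    by move/eqP; rewrite oner_eq0.
  have ij' : i != j by rewrite neq_ltn ij.
  have jk' : j != k by rewrite neq_ltn jk.
  have := eqN _ _ (roots_sub R ij') (roots_sub R jk') U1 U2.
  have ik := ltn_trans ij jk.
  case=> /(congr1 (dot (e k))); rewrite ?dotNr !dotBr !dot_basis2 eqxx -!val_eqE /=;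
  rewrite (ltn_eqF ik) (ltn_eqF jk) !subr0 ?oppr0;
  by move/eqP; rewrite oner_eq0.
- move=> D w k X w_ Ww k1 DX Xi Xo Xr _ IH U DE sU.
  rewrite DE in DX Ww Xr IH; have [sU' _] := sU.
  (* Non-orthogonal roots share a component. The roots of a bad configuration are linked by such
     pairs, so the whole configuration sits in one component. *)
  have same r r' : roots B r -> roots B r' -> U r -> U r' -> dot r r' != 0 ->
      forall m : 'I_k, X m r -> X m r'.
    move=> Br Br' Ur Ur' rr m Xr0.
    have [m' _ Xr'] : (\bigcup_i X i) r' by rewrite -DX.
    have [->//|mm] := eqVneq m m'.
    by move: rr; rewrite (Xo _ _ mm) ?eqxx.
  have comp r : roots B r -> U r -> exists m : 'I_k, X m r.
    by move=> Br Ur; have [m _ Xm] : (\bigcup_i X i) r; [rewrite -DX|exists m].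
  have free (m : 'I_k) : pattern_free (U `&` linspan (X m)) w.
    have sL := subspace_linspan (X m).
    have /(is_restrictionP _ sU' sL Ww)[_ ag] := Xr m.
    apply: (pattern_free_agree _ ag); first exact: subspaceI.
    apply: IH => //; first by rewrite restrict_restrict.
    exact: simply_spanned_component.
  split=> [i j ij Ui Uj|i j k' l ij jk kl U1 U2 U3].
    have ij' : i != j by rewrite neq_ltn ij.
    have [m Xi'] := comp _ (roots_basis R i) Ui.
    have Uij : U (e i + e j) by case: sU' => _ UD _; apply: UD.
    have Xij : X m (e i + e j).
      apply: same Xi' => //; [exact: roots_basis|exact: roots_add|].
      by rewrite dotDr !dot_basis2 eqxx (eq_sym j) (negPf ij') addr0 oner_neq0.
    have Xj : X m (e j).
      apply: same Xij => //; [exact: roots_add|exact: roots_basis|].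
      by rewrite dotDl !dot_basis2 eqxx (eq_sym j) (negPf ij') add0r oner_neq0.
    by apply: (free m).1 => //; split => //; exact: sub_linspan.
  have neq (x y : 'I_n) : (x < y)%N -> ((x != y) * (y != x))%type.
    by move=> xy; rewrite -!val_eqE /= (ltn_eqF xy) (gtn_eqF xy).
  have chain (x y z : 'I_n) : (x < y)%N -> (y < z)%N -> dot (e y - e x) (e z - e y) != 0.
    move=> xy yz; rewrite dotBr !dotBl !dot_basis2 eqxx.
    rewrite (negPf (neq _ _ xy).2) (negPf (neq _ _ yz).2) (negPf (neq _ _ (ltn_trans xy yz)).2).
    by rewrite !subr0 sub0r oppr_eq0 oner_neq0.
  have Bs (x y : 'I_n) : (x < y)%N -> roots B (e y - e x).
    by move=> xy; apply: roots_sub; rewrite neq.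
  have [m X1] := comp _ (Bs _ _ ij) U1.
  have X2 : X m (e k' - e j) by apply: same X1; auto.
  have X3 : X m (e l - e k') by apply: same X2; auto.
  by apply: (free m).2 => //; split => //; exact: sub_linspan.
- move=> D w a w' Ww _ sa wr _ IH piv U DE sU; have [sU' Us] := sU.
  rewrite DE in Ww sa wr IH piv; rewrite /= in sa wr IH.
  set L := linspan _ in wr IH.
  have sL : subspace L by exact: subspace_linspan.
  have UL : U `&` L = L by exact: linspan_simple_sub.
  have [_ ag] := (is_restrictionP w' sU' sL Ww).1 wr.
  have free : pattern_free L w.
    rewrite UL in ag; apply: (pattern_free_agree sL ag); apply: IH.
      by rewrite restrict_restrict UL.
    by apply: simply_spanned_linspan => x [[]].
  have nat_sub i j : (i < j)%N -> U (e j - e i) -> natspan (simple B `&` U) (e j - e i).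
    by move=> ij Uij; apply: Us; split => //; exact: pos_sub.
  have le_or_L i j : (i < j)%N -> U (e j - e i) ->
      root_le (restrict B U) a (e j - e i) \/ L (e j - e i).
    by move=> ij Uij; apply: root_le_or_linspan => //; exact: pos_sub.
  (* Since the roots above [a] are all inversions or all non-inversions, [w] gives them the same
     sign. *)
  have sign b c : pos B b -> pos B c -> U b -> U c ->
      root_le (restrict B U) a b -> root_le (restrict B U) a c ->
      (0 < dot rho (w *m b)) = (0 < dot rho (w *m c)).
    move=> pb pc Ub Uc ab ac.
    have Bw r : pos B r -> roots B (w *m r).
      by move=> /posP[Br _]; apply: weyl_roots => //; exact: weyl_restrict Ww.
    apply: negb_inj; rewrite -!rho_roots_leNgt; try exact: Bw.
    have invE r : pos B r -> U r -> (dot rho (w *m r) < 0) = `[< inversions (restrict B U) w r >].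
      move=> pr Ur; apply/idP/asboolP => [rw|]; first exact/inversions_restrict.
      by move/(inversions_restrict _ sU' Ww) => -[].
    rewrite !invE //; case: piv => [inv|noinv].
      by rewrite !asboolT //; apply: inv.
    have nin r : pos B r -> U r -> root_le (restrict B U) a r ->
        ~ inversions (restrict B U) w r.
      move=> pr Ur ar ri; suff : set0 r by []. by rewrite -noinv.
    by rewrite !asboolF //; exact: nin.
  have UD x y : U x -> U y -> U (x + y) by case: sU' => _ + _; apply.
  have [posS posA] := (@pos_sub R n, @pos_add R n).
  split=> [i j ij Ui Uj|i j k l ij jk kl U1 U2 U3].
    have ni : natspan (simple B `&` U) (e i) by apply: Us; split => //; exact: pos_basis.
    have nj : natspan (simple B `&` U) (e j) by apply: Us; split => //; exact: pos_basis.
    have Uji : U (e j - e i) by exact: subspaceB.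
    (* A mixed inversion gives [e j] and [e i + e j] different signs, although the second is above
       [a] as soon as the first is. *)
    have eq_sign : root_le (restrict B U) a (e j) -> ~ mixed_inversion (height w) i j.
      move=> aj; apply/negP; rewrite negbK -height_add; apply/eqP/sign => //.
      - exact: pos_basis.
      - exact: posA.
      - exact: UD.
      - by rewrite addrC; apply: root_leD.
    have [ai|Li] := @root_le_or_linspan U a (e i) sU (pos_basis R i) Ui.
      by apply: eq_sign; rewrite -[e j](subrK (e i)) addrC; apply: root_leD => //; exact: nat_sub.
    have [aij|Lij] := le_or_L _ _ ij Uji.
      by apply: eq_sign; rewrite -[e j](subrK (e i)); apply: root_leD.
    apply: free.1 => //; rewrite -[e j](subrK (e i)).
    by case: sL => _ LD _; exact: LD.
  have [ik jl] := (ltn_trans ij jk, ltn_trans jk kl); have il := ltn_trans ik kl.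
  have Uik : U (e k - e i) by rewrite (basis_add_sub i j); exact: UD.
  have Ujl : U (e l - e j) by rewrite (basis_add_sub j k); exact: UD.
  have Uil : U (e l - e i) by rewrite (basis_add_sub i k); exact: UD.
  have lt_sign (x y z t : 'I_n) : (x < y)%N -> (z < t)%N -> U (e y - e x) -> U (e t - e z) ->
      root_le (restrict B U) a (e y - e x) -> root_le (restrict B U) a (e t - e z) ->
      (height w x < height w y) = (height w z < height w t).
    move=> xy zt Uxy Uzt axy azt; rewrite -(subr_gt0 (height w x)) -(subr_gt0 (height w z)).
    by rewrite -!height_sub; apply: sign => //; exact: posS.
  (* If [a] is below the first or the second consecutive difference, it is below [e k - e i] and
     [e l - e i]; a crossing puts the value at [i] between those at [k] and [l], so these roots get
     different signs. *)
  have [a1|L1] := le_or_L _ _ ij U1.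
    have aik : root_le (restrict B U) a (e k - e i).
      by rewrite (basis_add_sub i j); apply: root_leD => //; exact: nat_sub.
    have ail : root_le (restrict B U) a (e l - e i).
      by rewrite (basis_add_sub i k); apply: root_leD => //; exact: nat_sub.
    have := lt_sign _ _ _ _ ik il Uik Uil aik ail.
    by move=> E [] [h1 h2 h3]; move: E; rewrite ?h3 ?h2 ltNge ltW.
  have [a2|L2] := le_or_L _ _ jk U2.
    have aik : root_le (restrict B U) a (e k - e i).
      by rewrite (basis_add_sub i j) addrC; apply: root_leD => //; exact: nat_sub.
    have ail : root_le (restrict B U) a (e l - e i).
      by rewrite (basis_add_sub i k); apply: root_leD => //; exact: nat_sub.
    have := lt_sign _ _ _ _ ik il Uik Uil aik ail.
    by move=> E [] [h1 h2 h3]; move: E; rewrite ?h3 ?h2 ltNge ltW.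
  (* Symmetrically, [e l - e i] and [e l - e j] are above [a], while a crossing puts the value at
     [l] between those at [i] and [j]. *)
  have [a3|L3] := le_or_L _ _ kl U3.
    have ajl : root_le (restrict B U) a (e l - e j).
      by rewrite (basis_add_sub j k) addrC; apply: root_leD => //; exact: nat_sub.
    have ail : root_le (restrict B U) a (e l - e i).
      by rewrite (basis_add_sub i k) addrC; apply: root_leD => //; exact: nat_sub.
    have := lt_sign _ _ _ _ il jl Uil Ujl ail ajl.
    by move=> E [] [h1 h2 h3]; move: E; rewrite ?h1 ?h2 ltNge ltW.
  exact: free.2.
Qed.

End Separable.

(** * Cuts and orthogonal decompositions *)

Section Cut.
Variable R : realDomainType.
Implicit Types (F : nat -> R) (p q c : nat).

Definition crossing_free F p q := forall i j k l,
  (p <= i)%N -> (i < j)%N -> (j < k)%N -> (k < l)%N -> (l <= q)%N ->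
  ~ (F j < F l /\ F l < F i /\ F i < F k) /\
  ~ (F k < F i /\ F i < F l /\ F l < F j).

(** For [F] this is a direct sum decomposition of the word at [c]; for the negated word, a skew sum
    decomposition. *)
Definition below F p q c := forall i j,
  (p <= i)%N -> (i < c)%N -> (c <= j)%N -> (j <= q)%N -> F i < F j.

Definition has_cut F p q := exists c, (p < c <= q)%N /\
  (below F p q c \/ below (fun k => - F k) p q c).

Definition injective_on F p q := forall i j,
  (p <= i)%N -> (i < j)%N -> (j <= q)%N -> F i != F j.

(* Take the first cut of the prefix: if the new value splits the values to its
   left, crossing-freeness makes the low ones precede the high ones, which is
   an earlier cut. *)
Lemma cut_extend F p q c : crossing_free F p q.+1 -> injective_on F p q.+1 ->
  (p < c <= q)%N -> below F p q c -> has_cut F p q.+1.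
Proof.
move=> cf inj cpq bc.
have [c0 /andP[cpq0 /asboolP bc0] c0min] :=
  ex_minnP (ex_intro (fun c => (p < c <= q)%N && `[< below F p q c >]) c
    (introT andP (conj cpq (introT (asboolP _) bc)))).
have {c cpq bc c0 cpq0 bc0 c0min} [c [cpq bc cmin]] : exists c, [/\ (p < c <= q)%N, below F p q c &
    forall d, (p < d <= q)%N -> below F p q d -> (c <= d)%N].
  by exists c0; split => // d dpq bd; apply: c0min; rewrite dpq; apply/asboolP.
have /andP[pc cq] := cpq.
have [lowA|] := pselect (forall i, (p <= i)%N -> (i < c)%N -> F i < F q.+1).
  exists c; split; first by rewrite pc leqW.
  left=> i j pi ic cj; rewrite leq_eqVlt => /predU1P[->|]; first exact: lowA.
  by rewrite ltnS; exact: bc.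
move=> /existsNP[v0 /not_implyP[pv0 /not_implyP[v0c /negP]]].
rewrite -leNgt le_eqVlt eq_sym (negPf (inj v0 q.+1 pv0 _ _)) /=; [|lia|by []].
move=> yv0.
have [v /and3P[pv vc yv] vmin] :=
  ex_minnP (ex_intro (fun v => [&& (p <= v)%N, (v < c)%N & F q.+1 < F v]) v0
    (introT and3P (And3 pv0 v0c yv0))).
have {}vmin i : (p <= i)%N -> (i < v)%N -> F i < F q.+1.
  move=> pi iv; rewrite lt_neqAle inj //=; last by lia.
  rewrite leNgt; apply/negP => yi; have := vmin i; rewrite pi yi /=; lia.
(* Here [v] is the leftmost position before [c] whose value exceeds the new one. If [p < v], then
   [v] would be an earlier cut; if [v = p], the new value lies below all others and gives a skew
   cut. *)
have [highA|] := pselect (forall i, (v <= i)%N -> (i < c)%N -> F q.+1 < F i).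
  have [pv'|vp] := ltnP p v.
    have : (c <= v)%N; last by lia.
    apply: cmin; first by lia.
    move=> i j pi iv vj jq; have [jc|cj] := ltnP j c; last by apply: bc => //; lia.
    by apply: lt_trans (vmin i pi iv) _; exact: highA.
  exists q.+1; split; first lia.
  right=> i j pi ij qj jq; have -> : j = q.+1 by lia.
  rewrite ltrN2; have [ic|ci] := ltnP i c; first by apply: highA => //; lia.
  by apply: lt_trans yv _; apply: bc => //; lia.
(* A later position [u] before [c] with a value below the new one makes [v], [u], [c], [q.+1] an
   occurrence of 3142. *)
move=> /existsNP[u /not_implyP[vu /not_implyP[uc /negP]]].
rewrite -leNgt le_eqVlt (negPf (inj u q.+1 _ _ _)) /=; [|lia|lia|by []].
move=> uy; have vu' : (v < u)%N.
  by rewrite ltn_neqAle vu andbT; apply/eqP => uv; move: yv; rewrite uv ltNge ltW.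
have [] := cf v u c q.+1 pv vu' uc cq (leqnn _); case; split => //; split => //.
by apply: bc.
Qed.

(** Induction on the length, appending one letter at a time to a word that already has a cut. *)
Lemma crossing_free_has_cut F p q : (p < q)%N ->
  crossing_free F p q -> injective_on F p q -> has_cut F p q.
Proof.
elim: q => // q IH pq cf inj.
have [pq'|qp] := ltnP p q; last first.
  have {pq qp} pq : p = q by lia.
  subst q; exists p.+1; split; first by rewrite ltnSn.
  have := inj p p.+1 (leqnn _) (leqnn _) (leqnn _).
  rewrite neq_lt => /orP[lt|gt]; [left|right] => i j pi ip pj jp;
  have [-> ->] : i = p /\ j = p.+1 by lia.
  - by [].
  - by rewrite ltrN2.
have [||c [cpq [bc|bc]]] := IH pq'.
- by move=> i j k l pi ij jk kl lq; apply: cf => //; exact: leqW.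
- by move=> i j pi ij jq; apply: inj => //; exact: leqW.
- exact: cut_extend cpq bc.
(* A skew cut is a direct cut of the negated word, and negation exchanges the patterns 3142 and
   2413. *)
have [||d [dpq bd]] := cut_extend _ _ cpq bc.
- move=> i j k l pi ij jk kl lq; rewrite !ltrN2.
  by have [h1 h2] := cf i j k l pi ij jk kl lq; split=> -[? []]; auto.
- by move=> i j pi ij jq; rewrite eqr_opp; apply: inj.
exists d; split => //; case: bd => bd; [by right|left] => i j pi ic cj jq.
by have := bd i j pi ic cj jq; rewrite !opprK.
Qed.

End Cut.

(** * Orthogonal decompositions into irreducible sets *)

Section Decomposition.
Variables (R : realFieldType) (n : nat).
Local Notation V := 'cV[R]_n.
Implicit Types (X Y Z : set V) (s : seq V).

Definition decomposition X k (Y : 'I_k -> set V) :=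
  [/\ X = \bigcup_i Y i, forall i, irreducible (Y i)
    & forall i j, i != j -> orthogonal (Y i) (Y j)].

Lemma orthogonal_sym X Y : orthogonal X Y -> orthogonal Y X.
Proof. by move=> XY x y Yx Xy; rewrite dotC; exact: XY. Qed.

Lemma decomposition_union Y Z k l (F : 'I_k -> set V) (G : 'I_l -> set V) :
  orthogonal Y Z -> decomposition Y F -> decomposition Z G ->
  decomposition (Y `|` Z) (fun i => match split i with inl a => F a | inr b => G b end).
Proof.
move=> YZ [YE Fi Fo] [ZE Gi Go]; split.
- rewrite YE ZE; apply/seteqP; split=> x.
    case=> -[a _ xa]; first by exists (lshift l a) => //; rewrite (unsplitK (inl a)).
    by exists (rshift k a) => //; rewrite (unsplitK (inr a)).
  by case=> i _; case: split => a xa; [left|right]; exists a.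
- by move=> i; case: split.
have FG a b : orthogonal (F a) (G b).
  by move=> x y Fx Gy; apply: YZ; [rewrite YE; exists a|rewrite ZE; exists b].
move=> i j; rewrite -(splitK i) -(splitK j) !unsplitK.
case: (split i) => a; case: (split j) => b ab.
- by apply: Fo; apply: contraNneq ab => ->.
- exact: FG.
- exact/orthogonal_sym/FG.
- by apply: Go; apply: contraNneq ab => ->.
Qed.

(** Induction on the length of a list containing [X]. Orthogonal sets of nonzero vectors are
    disjoint, so each half of a splitting loses an element of the list. *)
Lemma decomposition_exists s X : (forall x, X x -> x != 0 /\ x \in s) ->
  exists k (Y : 'I_k -> set V), decomposition X Y.
Proof.
have [N] := ubnP (size s); elim: N => // N IH in s X *; move=> sN Xs.
have [X0|/set0P X0] := eqVneq X set0.
  exists 0%N, (fun=> set0); split; [|by case..].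
  by rewrite X0; apply/seteqP; split => // x [[]].
have [Xi|] := pselect (irreducible X).
  exists 1%N, (fun=> X); split => //.
    by apply/seteqP; split => [x|x [_ _]//]; exists ord0.
  by move=> i j; rewrite !ord1.
move=> /not_andP[//|/contrapT[Y [Z [XE [y Yy] [z Zz] YZ]]]].
have disj x : Y x -> Z x -> False.
  move=> Yx Zx; have [|x0 _] := Xs x; first by rewrite XE; left.
  by move/dot_eq0: (YZ _ _ Yx Zx) => x00; rewrite x00 eqxx in x0.
have filter_lt (T : set V) t : X t -> ~ T t ->
    (size [seq x <- s | `[< T x >]] < N)%N.
  move=> Xt nT; have [_ ts] := Xs t Xt.
  apply: (@leq_trans (size s)); last by rewrite -ltnS.
  rewrite size_filter -(count_predC (fun x => `[< T x >])) -[X in (X < _)%N]addn0.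
  by rewrite ltn_add2l -has_count; apply/hasP; exists t => //=; rewrite asboolF.
have sub (T : set V) : T `<=` X -> forall x, T x ->
    x != 0 /\ x \in [seq x <- s | `[< T x >]].
  by move=> TX x Tx; have [x0 xs] := Xs x (TX x Tx); rewrite mem_filter xs asboolT.
have YX : Y `<=` X by rewrite XE; left.
have ZX : Z `<=` X by rewrite XE; right.
have [k [F dF]] := IH _ Y (filter_lt Y z (ZX _ Zz) (fun Yz => disj z Yz Zz)) (sub Y YX).
have [l [G dG]] := IH _ Z (filter_lt Z y (YX _ Yy) (disj y Yy)) (sub Z ZX).
by eexists; eexists; rewrite XE; exact: decomposition_union dF dG.
Qed.

Lemma decomposition_reducible X k (Y : 'I_k -> set V) : decomposition X Y ->
  X !=set0 -> ~ irreducible X -> (1 < k)%N.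
Proof.
case: k Y => [|[|k]] Y [XE Yi _] // X0 nX.
  by case: X0 => x; rewrite XE => -[[]].
case: nX; suff -> : X = Y ord0 by exact: Yi.
rewrite XE; apply/seteqP; split=> x; last by exists ord0.
by case=> i _; rewrite ord1.
Qed.

End Decomposition.

(** * Pattern-free elements are separable *)

Section Pivot.
Variables (R : realFieldType) (n : nat).
Local Notation V := 'cV[R]_n.
Local Notation M := 'M[R]_n.
Local Notation B := (rootsB R n).
Local Notation e := (@basis_vec R n).
Local Notation rho := (@rho R n).
Local Notation omega := (@omega R n).
Local Notation simple_root := (@simple_root R n).
Implicit Types (u v a b r : V) (g w : M) (s : seq V) (i j k l m : 'I_n) (U : set V).

Lemma simple_rootB m : simple B (simple_root m).
Proof. by apply/simple_rootP; exists m. Qed.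

(** If the index [g] were missing, [omega g] would vanish on all roots of [U]. Each root would then
    live either on the positions before [g] or on those from [g] on, an orthogonal splitting with
    [simple_root m1] and [simple_root m2] on different sides. *)
Lemma irreducible_convex U (m1 g m2 : 'I_n) : simply_spanned U ->
  irreducible (roots B `&` U) -> (m1 < g)%N -> (g < m2)%N ->
  U (simple_root m1) -> U (simple_root m2) -> U (simple_root g).
Proof.
move=> ssU [_ irr] m1g gm2 U1 U2; apply: contrapT => nU; apply: irr.
exists [set r | (roots B `&` U) r /\ forall i, (g <= i)%N -> r i 0 = 0].
exists [set r | (roots B `&` U) r /\ forall i, (i < g)%N -> r i 0 = 0].
split.
- apply/seteqP; split=> [r [Br Ur]|r [] []//].
  have r0 := omega_simply_spanned ssU nU Br Ur.
  suff [h|h] : (forall i, (g <= i)%N -> r i 0 = 0) \/ (forall i, (i < g)%N -> r i 0 = 0).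
  + by left.
  + by right.
  case: (Br) r0 => [[i [c ->]]|[i [j [c [d [ij ->]]]]]].
    rewrite dotZr omega_basis; case: leqP => [gi|ig _].
      by move/eqP; rewrite mulr1 signr_eq0.
    left=> k gk; rewrite mxE basis_vecE -val_eqE /= gtn_eqF ?mulr0 //.
    exact: leq_trans ig gk.
  rewrite dotDr !dotZr !omega_basis; have [gi|ig] := leqP g i.
    move=> _; right=> k kg; rewrite !mxE !eqxx !andbT -!val_eqE /=.
    by rewrite !ltn_eqF ?mulr0 ?addr0 //; [apply: leq_trans kg _; apply: leq_trans gi (ltnW ij)|apply: leq_trans kg gi].
  rewrite mulr0 add0r; case: leqP => [gj|jg _].
    by move/eqP; rewrite mulr1 signr_eq0.
  left=> k gk; rewrite !mxE !eqxx !andbT -!val_eqE /=.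
  by rewrite !gtn_eqF ?mulr0 ?addr0 //; [exact: leq_trans jg gk|exact: leq_trans ig gk].
- exists (simple_root m1); split; first by split => //; exact: roots_simple (simple_rootB _).
  move=> i gi; rewrite mxE -val_eqE /= !gtn_eqF ?subrr //; last exact: leq_trans gi.
  by apply: leq_trans (leqnSn _); apply: leq_trans gi.
- exists (simple_root m2); split; first by split => //; exact: roots_simple (simple_rootB _).
  move=> i ig; rewrite mxE -val_eqE /= !ltn_eqF ?subrr //; last exact: ltn_trans gm2.
  exact: leq_ltn_trans gm2.
- move=> x y [_ x0] [_ y0]; rewrite /dot big1 // => i _.
  by have [gi|ig] := leqP g i; [rewrite x0 ?mul0r|rewrite y0 ?mulr0].
Qed.

Lemma simple_root_exists U : simply_spanned U -> (roots B `&` U) !=set0 ->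
  exists m, U (simple_root m).
Proof.
move=> [sU Us] [r [Br Ur]].
have [r' [pr' Ur']] : (pos B `&` U) !=set0.
  case: (roots_cases Br) => pr; first by exists r.
  by exists (- r); split => //; exact: subspaceN.
have [[|a s] sU' rE] := Us r' (conj pr' Ur').
  have /posP[/roots_neq0] := pr'.
  by rewrite rE big_nil eqxx.
have [/simple_rootP[m aE] Ua] := sU' a (mem_head _ _).
by exists m; rewrite -aE.
Qed.

(** The uniform sign condition of (S3), where being above [simple_root m] is expressed by a positive
    coordinate at [m]. *)
Definition pivot U w m :=
  (forall b, pos B b -> U b -> 0 < dot (omega m) b -> dot rho (w *m b) < 0) \/
  (forall b, pos B b -> U b -> 0 < dot (omega m) b -> 0 < dot rho (w *m b)).

(** * Pivots when the simple roots of the subsystem have the indices [p..q] *)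

Section Interval.
Variables (U : set V) (w : M) (p q : 'I_n).
Hypotheses (ssU : simply_spanned U) (Ww : weyl B w) (pf : pattern_free U w).
Hypotheses (pq : (p <= q)%N).
Hypothesis UK : forall m, (p <= m <= q)%N <-> U (simple_root m).
Local Notation f := (height w).

Let sU : subspace U := ssU.1.

Let vanish m r : roots B r -> U r -> ~~ (p <= m <= q)%N -> dot (omega m) r = 0.
Proof.
by move=> Br Ur /negP pmq; apply: (omega_simply_spanned ssU) => // /UK.
Qed.

Let f_neq0 i : f i != 0.
Proof. by apply/rho_roots_neq0/weyl_roots => //; exact: roots_basis. Qed.

(** Type B: the pivot is the least [c] from which all letters up to [q] have the sign of the last
    one. Every root above it then gets this sign. *)
Lemma pivotB : p = 0%N :> nat -> exists2 m, U (simple_root m) & pivot U w m.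
Proof.
move=> p0; have Ue i : (i <= q)%N -> U (e i).
  move=> iq; apply: (natspan_sub sU (X := U)) => //; apply: natspan_basis => m mi.
  by apply/UK; rewrite p0 (leq_trans mi).
have le_q r j : roots B r -> U r -> dot (omega j) r != 0 -> (j <= q)%N.
  move=> Br Ur; apply: contraNT => jq; rewrite vanish ?eqxx //.
  by rewrite negb_and jq orbT.
have sgn i j : (i < j)%N -> (j <= q)%N -> (0 < f j) = (0 < f i + f j).
  move=> ij jq; apply/eqP; apply: contrapT => /negP.
  by apply: pf.1 => //; apply: Ue => //; rewrite ltnW // (leq_trans ij).
pose P c := (c <= q)%N && [forall j : 'I_n, (c <= j <= q)%N ==> ((0 < f j) == (0 < f q))].
have exP : exists c, P c.
  exists q; rewrite /P leqnn; apply/forallP => j; apply/implyP.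
  by rewrite -eqn_leq => /eqP/val_inj ->.
have [c /andP[cq /forallP cP] cmin] := ex_minnP exP.
have {}cP j : (c <= j)%N -> (j <= q)%N -> (0 < f j) = (0 < f q).
  by move=> cj jq; have := cP j; rewrite cj jq => /eqP.
(* This is clear if the letters at [i] and [j] have opposite signs. Otherwise the letter [l] just
   before [c] has the other sign by minimality of [c], and the absence of mixed inversions makes
   absolute values grow from [i] to [l] to [j]. *)
have sgn_sub i j : (i < c)%N -> (c <= j)%N -> (j <= q)%N ->
    (0 < f j - f i) = (0 < f j).
  move=> ic cj jq; have ij := leq_trans ic cj.
  have ln : (c.-1 < n)%N by apply: leq_ltn_trans (ltn_ord j); lia.
  have [l lE] : exists l : 'I_n, l = c.-1 :> nat by exists (Ordinal ln).
  have lq : (0 < f l) != (0 < f q).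
    apply/negP => /eqP lq; have : (c <= c.-1)%N; last by lia.
    apply: cmin; rewrite /P (leq_trans (leq_pred c) cq); apply/forallP => k.
    apply/implyP => /andP[ck kq]; have [ck'|kc] := leqP c k; first by rewrite cP.
    by rewrite (_ : k = l) ?lq //; apply/val_inj; rewrite /= lE; lia.
  have := f_neq0 i; have := f_neq0 j; have := f_neq0 l; rewrite !neq_lt.
  have [fij|/eqP fij] := eqVneq (0 < f i) (0 < f j); last first.
    by move: fij; case: (ltrP 0 (f i)); case: (ltrP 0 (f j)) => //= h1 h2 _ _ _ _; [apply/negbTE; rewrite -leNgt|]; lra.
  have il : (i < l)%N.
    rewrite ltn_neqAle lE (_ : (i <= c.-1)%N) ?andbT; last by lia.
    apply/negP; rewrite -lE => /eqP/val_inj il.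
    by move: lq; rewrite -(cP j) // -fij il eqxx.
  have lj : (l < j)%N by rewrite lE; lia.
  have lq' : (l <= q)%N by rewrite lE; lia.
  have := sgn _ _ il lq'; have := sgn _ _ lj jq.
  move: lq; rewrite -(cP j) //.
  case: (ltrP 0 (f l)); case: (ltrP 0 (f j)) => //= h1 h2 _.
    move=> /esym/negbT; rewrite -leNgt => h3 /esym h4 _ _ _.
    by apply/negbTE; rewrite -leNgt; lra.
  move=> /esym h3 /esym/negbT; rewrite -leNgt => h4 _ _ _; lra.
have cn : (c < n)%N by exact: leq_ltn_trans (ltn_ord q).
have Bij i j (d : bool) : (i < j)%N -> roots B ((-1) ^+ d *: e i + e j).
  by move=> ij; right; exists i, j, d, false; rewrite scale1r.
have sign b : pos B b -> U b -> 0 < dot (omega (Ordinal cn)) b ->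
    (0 < dot rho (w *m b)) = (0 < f q).
  case=> [[i [j [d [ij ->]]]]|[i ->]] Ub; last first.
    rewrite omega_basis; case: leqP; rewrite ?ltxx // => ci _.
    rewrite -/(height w i) cP //; apply: (le_q (e i)) => //; first exact: roots_basis.
    by rewrite omega_basis leqnn oner_neq0.
  have jq : (j <= q)%N.
    apply: (le_q _ _ (Bij i j d ij) Ub).
    by rewrite dotDr dotZr !omega_basis leqnn leqNgt ij mulr0 add0r oner_neq0.
  rewrite dotDr dotZr !omega_basis /= => cb.
  have cj : (c <= j)%N.
    rewrite leqNgt; apply/negP => jc; move: cb.
    by rewrite (leqNgt c i) (leqNgt c j) jc (ltn_trans ij jc) mulr0 addr0 ltxx.
  case: d Ub cb => Ub; rewrite ?expr0 ?expr1 ?scale1r ?scaleN1r.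
    rewrite [- e i + e j]addrC height_sub cj mulN1r; case: leqP => [ci|ic _]; first by rewrite addNr ltxx.
    by rewrite sgn_sub // cP.
  by rewrite height_add => _; rewrite -sgn // cP.
exists (Ordinal cn); first by apply/UK; rewrite p0.
have [fq|fq] := ltrP 0 (f q); [right|left] => b pb Ub cb; first by rewrite sign.
have /posP[Bb _] := pb.
by rewrite rho_roots_leNgt ?sign // -?leNgt //; exact: weyl_roots.
Qed.

(** Type A: the roots involve the positions from [p.-1] to [q], because [simple_root p] is a
    difference of two basis vectors. The pivot is a cut of the word on these positions; the roots
    above it straddle the cut. *)
Lemma pivotA : (0 < p)%N -> exists2 m, U (simple_root m) & pivot U w m.
Proof.
move=> p0.
have Ue i j : (p.-1 <= i)%N -> (i < j)%N -> (j <= q)%N -> U (e j - e i).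
  move=> pi ij jq; apply: (natspan_sub sU (X := U)) => //.
  by apply: natspan_sub_basis => // m /andP[im mj]; apply/UK; lia.
(* The default [p] is harmless, as [F] is only read at positions up to [q]. *)
pose F (k : nat) := f (insubd p k).
have FE i : F i = f i by rewrite /F valKd.
have valq (k : nat) : (k <= q)%N -> insubd p k = k :> nat.
  by move=> kq; rewrite insubdK // unfold_in; exact: leq_ltn_trans (ltn_ord q).
have pq' : (p.-1 < q)%N by lia.
have [||c [/andP[pc cq] cut]] := @crossing_free_has_cut _ F _ _ pq'.
- move=> i j k l pi ij jk kl lq.
  have [kq jq iq] : [/\ (k <= q)%N, (j <= q)%N & (i <= q)%N] by split; lia.
  have nocross : ~ crossing f (insubd p i) (insubd p j) (insubd p k) (insubd p l).
    by apply: pf.2; rewrite ?valq //; apply: Ue; rewrite ?valq //; lia.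
  by split=> -[h1 [h2 h3]]; apply: nocross; [left|right].
- move=> i j pi ij jq; have iq : (i <= q)%N by lia.
  rewrite eq_sym -subr_eq0 /F -height_sub; apply/rho_roots_neq0/weyl_roots => //.
  by apply: roots_sub; rewrite -val_eqE /= neq_ltn !valq // ij.
have cn : (c < n)%N by exact: leq_ltn_trans (ltn_ord q).
have pos_cases b : pos B b -> U b -> exists i j,
    [/\ (p.-1 <= i)%N, (i < j)%N, (j <= q)%N & b = e j - e i].
  move=> /[dup] pb /posP[Bb _] Ub; have n0 : (0 < n)%N by exact: leq_ltn_trans cn.
  (* This pairing is the sum of all coordinates; its vanishing excludes [e i] and [e i + e j],
     leaving differences. The coordinates at [i + 1] and [j] then bound the two positions. *)
  have o0 : dot (omega (Ordinal n0)) b = 0.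
    by apply: vanish => //; rewrite /= leqNgt p0.
  case: pb Bb Ub o0 => [[i [j [d [ij ->]]]]|[i ->]] Bb Ub; last first.
    by move/eqP; rewrite omega_basis oner_eq0.
  rewrite dotDr dotZr !omega_basis /=; case: d Bb Ub => Bb Ub; last first.
    by rewrite expr0 => ?; exfalso; lra.
  move=> _; exists i, j; split => //; last by rewrite addrC scaleN1r.
    rewrite leqNgt; apply/negP => ip; have jn := leq_ltn_trans ij (ltn_ord j).
    have := @vanish (Ordinal jn) _ Bb Ub; rewrite dotDr dotZr !omega_basis /=.
    rewrite ij ltnn mulr0 add0r => /(_ _)/eqP; rewrite oner_eq0 => H.
    by apply: notF; apply: H; rewrite negb_and -!ltnNge; apply/orP; left; lia.
  rewrite leqNgt; apply/negP => qj.
  have := @vanish j _ Bb Ub; rewrite dotDr dotZr !omega_basis /=.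
  rewrite leqnn (leqNgt j i) ij mulr0 add0r => /(_ _)/eqP; rewrite oner_eq0 => H.
  by apply: notF; apply: H; rewrite negb_and -!ltnNge qj orbT.
exists (Ordinal cn); first by apply/UK => /=; lia.
have straddle b : pos B b -> U b -> 0 < dot (omega (Ordinal cn)) b -> exists i j,
    [/\ (p.-1 <= i)%N, (i < c)%N, (c <= j)%N, (j <= q)%N & b = e j - e i].
  move=> pb Ub; have [i [j [pi ij jq ->]]] := pos_cases b pb Ub.
  rewrite dotBr !omega_basis /= => cb; exists i, j.
  by move: cb; case: (leqP c i) => ci; case: leqP => cj; rewrite ?subrr ?ltxx //; lia.
case: cut => bc; [right|left] => b pb Ub /(straddle b pb Ub)[i [j [pi ic cj jq ->]]];
  have := bc i j pi ic cj jq; rewrite !FE height_sub ?ltrN2.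
  by rewrite subr_gt0.
by rewrite subr_lt0.
Qed.

End Interval.

(** By convexity the simple roots of [U] have indices filling an interval; it gives type B if it
    contains 0 and type A otherwise. *)
Lemma irreducible_pivot U w : simply_spanned U -> irreducible (roots B `&` U) ->
  weyl B w -> pattern_free U w -> exists2 m, U (simple_root m) & pivot U w m.
Proof.
move=> ssU irr Ww pf; have [m0 Um0] := simple_root_exists ssU irr.1.
pose K m := `[< U (simple_root m) >].
have Km0 : K m0 by exact/asboolP.
have [p /asboolP Up pmin] := @arg_minnP _ m0 K val Km0.
have [q /asboolP Uq qmax] := @arg_maxnP _ m0 K val Km0.
have pq : (p <= q)%N by apply: qmax; exact/asboolP.
have UK m : (p <= m <= q)%N <-> U (simple_root m).
  split=> [/andP[]|Um]; last first.
    have Km : K m by exact/asboolP.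
    by apply/andP; split; [exact: pmin|exact: qmax].
  rewrite leq_eqVlt => /predU1P[/val_inj <- //|pm].
  rewrite leq_eqVlt => /predU1P[/val_inj -> //|mq].
  exact: irreducible_convex irr pm mq Up Uq.
have [p0|p0] := posnP p; first exact: pivotB ssU Ww pf pq UK p0.
exact: pivotA ssU Ww pf pq UK p0.
Qed.

Lemma roots_finite : exists s, forall r, roots B r -> r \in s.
Proof.
pose F (x : bool * 'I_n) : V := (-1) ^+ x.1 *: e x.2.
pose G (x : (bool * 'I_n) * (bool * 'I_n)) : V := F x.1 + F x.2.
exists (codom F ++ codom G) => r [[i [c ->]]|[i [j [b [c [_ ->]]]]]]; rewrite mem_cat.
  by rewrite (codom_f F (c, i)).
by rewrite (codom_f G ((b, i), (c, j))) orbT.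
Qed.

Definition rank U := #|[pred m | `[< U (simple_root m) >]]|.

Lemma rank_lt U U' m : U' `<=` U -> U (simple_root m) -> ~ U' (simple_root m) ->
  (rank U' < rank U)%N.
Proof.
move=> UU Um nU'; apply: proper_card; apply/properP; split.
  by apply/fintype.subsetP => k; rewrite !inE; exact: UU.
by exists m; rewrite !inE //; apply/negP => /asboolW.
Qed.

(** Induction on the number of simple roots in [U]: removing a pivot, or passing to a component of a
    reducible system, loses at least one. *)
Lemma pattern_free_separable U w : simply_spanned U ->
  weyl (restrict B U) w -> pattern_free U w -> separable (restrict B U) w.
Proof.
have [N] := ubnP (rank U); elim: N => // N IH in U w *.
rewrite ltnS => UN ssU Ww pf; have [sU Us] := ssU.
have WwB := weyl_restrict Ww.
have [D0|/set0P D0] := eqVneq (roots B `&` U) set0.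
  exact: Separable_trivial.
have [irr|nirr] := pselect (irreducible (roots B `&` U)).
  have [m Um piv] := irreducible_pivot ssU irr WwB pf.
  set a := simple_root m; pose J := (simple B `&` U) `\ a.
  have sJ : J `<=` simple B by move=> x [[]].
  have sL : subspace (linspan J) by exact: subspace_linspan.
  have UL : U `&` linspan J = linspan J by exact: linspan_simple_sub.
  have LU : linspan J `<=` U by rewrite -UL => x [].
  have [w' Ww' ag] := restriction_exists sL WwB.
  apply: (@Separable_irreducible _ _ _ _ a w') => //.
  - by split => //; exact: simple_rootB.
  - by apply/is_restrictionP; rewrite ?UL.
  - rewrite restrict_restrict UL; apply: IH => //.
    + apply: leq_trans UN; apply: (rank_lt LU Um) => La.
      have nJ : ~ J a by move=> [_ []].
      by have /eqP := omega_linspan sJ nJ La; rewrite omega_simple_root eqxx oner_eq0.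
    + exact: simply_spanned_linspan.
    + apply: (pattern_free_agree sL (w' := w)); last exact: pattern_free_sub pf.
      by move=> r Br Lr; rewrite ag.
  have above b : root_le (restrict B U) a b -> 0 < dot (omega m) b.
    move=> [s sU' ab]; rewrite -(subrK a b) ab dotDr omega_sum => [|x /sU'[]//].
    by rewrite omega_simple_root eqxx addrC ltr_wpDr.
  case: piv => piv; [left|right].
    move=> b [[pb Ub] ab]; apply/inversions_restrict => //; split => //.
    by apply: piv => //; exact: above.
  apply/seteqP; split => // b [[[pb Ub] ab] /(inversions_restrict _ sU Ww)[_ _]].
  by rewrite ltNge ltW //; apply: piv => //; exact: above.
have [s sB] := roots_finite.
have [k [X dX]] : exists (k : nat) (X : 'I_k -> set V), decomposition (roots B `&` U) X.
  by apply: (@decomposition_exists _ _ s) => r [Br _]; split; [exact: roots_neq0|exact: sB].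
have k1 := decomposition_reducible dX D0 nirr.
have [XE Xi Xo] := dX.
have sL c : subspace (linspan (X c)) by exact: subspace_linspan.
have /choice[w_ w_P] c : exists w', weyl (restrict B (U `&` linspan (X c))) w' /\
    agree (U `&` linspan (X c)) w w'.
  have [w' ? ?] := restriction_exists (subspaceI sU (sL c)) WwB.
  by exists w'.
apply: (@Separable_reducible _ _ _ _ k X w_) => // c.
  by apply/is_restrictionP; [exact: sU|exact: sL|exact: Ww|exact: w_P].
have [Ww_ ag] := w_P c.
rewrite restrict_restrict; apply: IH => //; last 2 first.
- exact: simply_spanned_component XE Xo.
- apply: (pattern_free_agree (subspaceI sU (sL c)) (w' := w)).
    by move=> r Br Ur; rewrite ag.
  by apply: pattern_free_sub pf => x [].
apply: leq_trans UN.
have [d dc] : exists d : 'I_k, d != c.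
  have [c0|c0] := eqVneq c (Ordinal (ltnW k1)); last by exists (Ordinal (ltnW k1)); rewrite eq_sym.
  by exists (Ordinal k1); rewrite c0.
have [r Xr] := (Xi d).1.
have [Br Ur] : (roots B `&` U) r by rewrite XE; exists d.
(* If all simple roots of [U] lay in the span of [X c], so would the root [r] of another component,
   which is orthogonal to that span. *)
have [m Um nLm] : exists2 m, U (simple_root m) & ~ linspan (X c) (simple_root m).
  apply: contrapT => no.
  have Lpos r' : pos B r' -> U r' -> linspan (X c) r'.
    move=> pr' Ur'; have := Us r' (conj pr' Ur'); apply: natspan_sub => //.
    move=> x [/simple_rootP[m ->] Um]; apply: contrapT => nL.
    by apply: no; exists m.
  have Lr : linspan (X c) r.
    case: (roots_cases Br) => pr; first exact: Lpos.
    by rewrite -[r]opprK; apply: subspaceN => //; apply: Lpos => //; exact: subspaceN.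
  have /eqP := linspan_dot0 (fun x Xx => Xo d c dc r x Xr Xx) Lr.
  by rewrite gt_eqF // dot_roots_gt0.
by apply: (rank_lt _ Um) => [x []//|[]].
Qed.

End Pivot.

(** * Parabolic factorizations *)

Section Parabolic.
Variables (R : realFieldType) (n : nat).
Local Notation V := 'cV[R]_n.
Local Notation M := 'M[R]_n.
Local Notation B := (rootsB R n).
Local Notation e := (@basis_vec R n).
Local Notation rho := (@rho R n).
Local Notation omega := (@omega R n).
Local Notation simple_root := (@simple_root R n).
Implicit Types (u v a b r : V) (g w : M) (s : seq V) (i j m : 'I_n) (J U : set V).

(** The exchange condition: the letters of [s] act on [a] from the right, and the one that makes the
    vector negative can be deleted. *)
Lemma exchange s a : (forall x, x \in s -> simple B x) -> simple B a ->
  dot rho (refl_prod s *m a) < 0 ->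
  exists t, [/\ forall x, x \in t -> simple B x, (size t < size s)%N
    & refl_prod s *m refl a = refl_prod t].
Proof.
move=> + sa; have /posP[Ba a0] := pos_simple sa.
elim: s => [|b s IH] sB.
  by rewrite refl_prod_nil mul1mx ltNge ltW.
have sb : simple B b by apply: sB; rewrite mem_head.
have {}sB x : x \in s -> simple B x by move=> xs; apply: sB; rewrite inE xs orbT.
rewrite refl_prod_cons -mulmxA => neg.
have [sneg|spos] := ltrP (dot rho (refl_prod s *m a)) 0.
  have [t [tB ts tE]] := IH sB sneg; exists (b :: t); split=> //.
    by move=> x; rewrite inE => /predU1P[->|/tB].
  by rewrite refl_prod_cons -mulmxA tE.
have Ws : refl_group (simple B) (refl_prod s) by exists s.
have Bv : roots B (refl_prod s *m a).
  by apply: weyl_roots => //; apply: refl_group_sub Ws => x /roots_simple; exact: refl_group_refl.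
(* [b] is the only positive root that its reflection makes negative; conjugating [refl a] then
   yields [refl b], which cancels the head of the word. *)
have vb : refl_prod s *m a = b.
  apply: contrapT => /eqP vb; move: neg; rewrite rho_roots_leNgt; last first.
    by apply: roots_refl => //; exact: roots_simple.
  rewrite rho_simple_refl //; first by rewrite lt_neqAle eq_sym rho_roots_neq0 // spos.
  apply/eqP => vNb; move: spos; rewrite vNb dotNr oppr_ge0.
  by have /posP[_] := pos_simple sb; rewrite ltNge => /negP.
exists s; split=> //.
rewrite -vb (refl_conj _ (refl_group_orthogonal Ws)) -!mulmxA.
by rewrite (mulmxA _^T) (refl_group_orthogonal Ws) mul1mx refl_involutive mulmx1.
Qed.

Lemma length_exists w : weyl B w -> exists l, is_length B w l.
Proof.
move=> /weyl_simple_group[s sB wE].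
pose P l := `[< exists s, [/\ size s = l, forall x, x \in s -> simple B x & w = refl_prod s] >].
have [|l /asboolW lP lmin] := @ex_minnP P.
  by exists (size s); apply/asboolP; exists s.
exists l; split => // t tB tE; apply: lmin; apply/asboolP.
by exists t.
Qed.

Lemma simple_linspan J a : J `<=` simple B -> simple B a -> linspan J a -> J a.
Proof.
move=> sJ /simple_rootP[m ->] Jm; apply: contrapT => nJ.
have /eqP := omega_linspan sJ nJ Jm.
by rewrite omega_simple_root eqxx oner_eq0.
Qed.

(** That [w_J] is the restriction of [w]: the minimal [u] keeps positive the positive roots in the
    span of [J], and [v] preserves this span, so [u] does not change signs there. *)
Lemma parabolic_agree J w (u v : M) : J `<=` simple B -> weyl B w ->
  parabolic_factorization B J w u v -> agree (linspan J) w v.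
Proof.
move=> sJ Ww [Jv wE [k [[s [sk sB uE]] kmin] umin]].
have sL := subspace_linspan J.
have ov := refl_group_orthogonal Jv.
have JW g : refl_group J g -> weyl B g.
  by apply: refl_group_sub => x /sJ/roots_simple; exact: refl_group_refl.
have Wu : weyl B u.
  rewrite -[u]mulmx1 -(orthogonal_mxC ov) mulmxA -wE; apply: refl_group_mul => //.
  exact: refl_group_tr (JW _ Jv).
(* If [u] made [a] negative, the exchange condition would give a shorter element [u *m refl a] of
   the same coset [w W_J]. *)
have uJ a : J a -> 0 < dot rho (u *m a).
  move=> Ja; have sa := sJ a Ja.
  have Bua : roots B (u *m a) by apply: weyl_roots => //; exact: roots_simple.
  rewrite ltNge le_eqVlt (negPf (rho_roots_neq0 Bua)) /= uE; apply/negP.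
  move=> /(exchange sB sa)[t [tB ts tE]].
  have Jx : refl_group J (v^T *m refl a).
    by apply: refl_group_mul; [exact: refl_group_tr|exact: refl_group_refl].
  have wx : w *m (v^T *m refl a) = refl_prod t.
    by rewrite wE mulmxA -(mulmxA u) orthogonal_mxC // mulmx1 uE.
  have [l wl] : exists l, is_length B (w *m (v^T *m refl a)) l.
    by apply: length_exists; apply: refl_group_mul => //; exact: JW.
  have := umin _ _ Jx wl; have [_ lmin] := wl.
  by move=> kl; have := leq_ltn_trans (leq_trans kl (lmin t tB wx)) ts; rewrite sk ltnn.
have upos r : pos B r -> linspan J r -> 0 < dot rho (u *m r).
  move=> pr Lr; have /posP[Br _] := pr.
  have [_ Ls] := simply_spanned_linspan sJ.
  have [t tL rE] := Ls r (conj pr Lr).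
  rewrite lt_neqAle eq_sym rho_roots_neq0 /=; last exact: weyl_roots.
  rewrite rE mulmx_sumr dot_sumr big_seq sumr_ge0 // => x /tL[sx Lx].
  by apply/ltW/uJ; exact: simple_linspan.
move=> r Br Lr; have Bv : roots B (v *m r) by apply: weyl_roots => //; exact: JW.
have Lv : linspan J (v *m r) by apply: refl_group_subspace Jv Lr => //; exact: sub_linspan.
rewrite wE -mulmxA; have [pv|pv] := roots_cases Bv.
  by rewrite upos //; have /posP[_ ->] := pv.
have := upos _ pv (subspaceN sL Lv); have /posP[_] := pv.
by rewrite mulmxN !dotNr !oppr_gt0 => h1 h2; rewrite !ltNge !ltW.
Qed.

Lemma parabolic_factorization_exists J w : J `<=` simple B -> weyl B w ->
  exists u v : M, parabolic_factorization B J w u v.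
Proof.
move=> sJ Ww.
have JW g : refl_group J g -> weyl B g.
  by apply: refl_group_sub => x /sJ/roots_simple; exact: refl_group_refl.
pose P l := `[< exists2 x, refl_group J x & is_length B (w *m x) l >].
have [|l /asboolW [x Jx xl] lmin] := @ex_minnP P.
  have [l wl] := length_exists Ww; exists l; apply/asboolP; exists 1%:M.
    exact: refl_group1.
  by rewrite mulmx1.
exists (w *m x), x^T; split; first exact: refl_group_tr.
  by rewrite -mulmxA orthogonal_mxC ?mulmx1 //; exact: refl_group_orthogonal Jx.
exists l => // y l' Jy yl'; apply: lmin; apply/asboolP.
by exists y.
Qed.

Lemma minimal_non_separableP w : (0 < n)%N -> weyl B w ->
  minimal_non_separable B w <->
  [/\ exists i j, (i < j)%N /\ mixed_inversion (height w) i j,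
      forall i j, (i < j)%N -> (j < n.-1)%N -> ~ mixed_inversion (height w) i j
    & forall i j (k l : 'I_n), (i < j)%N -> (j < k)%N -> (k < l)%N ->
        ~ crossing (height w) i j k l].
Proof.
move=> n0 Ww.
(* Minimality makes each proper parabolic part separable, hence pattern-free, and this transfers to
   [w] by agreement of signs. *)
have sub_free J : J `<` simple B -> minimal_non_separable B w ->
    pattern_free (linspan J) w.
  move=> pJ [_ _ /(_ J pJ)[u [v [fac sep]]]]; have [sJ _] := pJ.
  apply: (pattern_free_agree (subspace_linspan J) (parabolic_agree sJ Ww fac)).
  by apply: separable_pattern_free sep _ _ _ => //; exact: simply_spanned_linspan.
have drop m : simple B `\ simple_root m `<` simple B.
  split=> [x []//|sub]; have [_] := sub _ (simple_rootB R m).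
  exact.
have mem_drop m (k : 'I_n) : k != m -> (simple B `\ simple_root m) (simple_root k).
  move=> km; split; first exact: simple_rootB.
  move=> /(congr1 (dot (omega m)))/eqP.
  by rewrite !omega_simple_root eqxx (eq_sym m) (negPf km) eq_sym oner_eq0.
split=> [min|[[i [j [ij cut_ij]]] ncut ncross]]; last first.
  split=> // [sep|J pJ].
    have [nc _] := separable_pattern_free sep (esym (restrictT R n)) (simply_spannedT R n).
    exact: nc cut_ij.
  have [sJ nJ] := pJ.
  have [u [v fac]] := parabolic_factorization_exists sJ Ww.
  exists u, v; split => //; apply: pattern_free_separable.
  - exact: simply_spanned_linspan.
  - have [Jv _ _] := fac; apply: refl_group_sub Jv => a Ja.
    by apply: refl_group_refl; split; [exact/roots_simple/sJ|exact: sub_linspan].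
  have [m nJm] : exists m, ~ J (simple_root m).
    apply: contrapT => no; apply: nJ => x /simple_rootP[m ->].
    by apply: contrapT => nJm; apply: no; exists m.
  apply: (@pattern_free_agree _ _ _ _ w); first exact: subspace_linspan.
    by move=> r Br Lr; rewrite -(parabolic_agree sJ Ww fac).
  (* A proper [J] misses some index [m], and [e y] can lie in its span only for [y < m]; so mixed
     inversions ending at the last position are invisible there. *)
  split=> [x y xy _ Ly|x y z t xy yz zt _ _ _]; last exact: ncross.
  apply: ncut => //; have /eqP := omega_linspan sJ nJm Ly.
  by rewrite omega_basis pnatr_eq0 eqb0 -ltnNge; have := ltn_ord m; lia.
have ncut i j : (i < j)%N -> (j < n.-1)%N -> ~ mixed_inversion (height w) i j.
  (* Dropping the last simple root leaves every [e k] except the last one. *)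
  move=> ij jn; have mn : (n.-1 < n)%N by lia.
  have [free _] := sub_free _ (drop (Ordinal mn)) min.
  have L (k : 'I_n) : (k <= j)%N -> linspan (simple B `\ simple_root (Ordinal mn)) (e k).
    move=> kj; apply: natspan_sub (subspace_linspan _) (@sub_linspan _ _ _) _ _.
    apply: natspan_basis => m mk; apply: mem_drop; rewrite -val_eqE /=; lia.
  by apply: free => //; apply: L => //; exact: ltnW.
have ncross i j (k l : 'I_n) : (i < j)%N -> (j < k)%N -> (k < l)%N ->
    ~ crossing (height w) i j k l.
  move=> ij jk kl.
  (* Dropping the first simple root leaves type A on all [n] positions, hence every difference. *)
  have [_ free] := sub_free _ (drop (Ordinal n0)) min.
  have L (x y : 'I_n) : (x < y)%N -> linspan (simple B `\ simple_root (Ordinal n0)) (e y - e x).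
    move=> xy; apply: natspan_sub (subspace_linspan _) (@sub_linspan _ _ _) _ _.
    apply: natspan_sub_basis => // m mk; apply: mem_drop; rewrite -val_eqE /=; lia.
  by apply: free => //; exact: L.
split=> //; apply: contrapT => no; have [_ nsep _] := min; apply: nsep.
rewrite -(restrictT R n); apply: pattern_free_separable.
- exact: simply_spannedT.
- by rewrite restrictT.
- split=> [i j ij _ _ cut|i j k l ij jk kl _ _ _]; last exact: ncross.
  by apply: no; exists i, j.
Qed.

End Parabolic.

(** * Words and patterns *)

Section Patterns.
Implicit Types (a b u : seq int) (i j k l : nat).

Lemma subseq_nth (T : eqType) (x0 : T) (s b : seq T) :
  subseq b s <-> exists I : seq nat,
    [/\ sorted ltn I, all (fun i => i < size s)%N I & b = [seq nth x0 s i | i <- I]].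
Proof.
split=> [/subseqP[m sm ->]|[I [sI /allP Is ->]]].
  exists (mask m (iota 0 (size s))); split.
  - exact: (subseq_sorted ltn_trans (mask_subseq _ _) (iota_ltn_sorted _ _)).
  - apply/allP => i /(mem_subseq (mask_subseq _ _)).
    by rewrite mem_iota.
  - by rewrite map_mask map_nth_iota0 // take_size.
(* A strictly increasing list of indices is determined by its elements, so it is a filtered [iota],
   and mapping turns this into a subsequence of [s]. *)
suff IE : I = [seq i <- iota 0 (size s) | i \in I].
  rewrite -[s in subseq _ s](mkseq_nth x0) /mkseq {1}IE.
  by apply: map_subseq; exact: filter_subseq.
apply: (irr_sorted_eq ltn_trans ltnn sI).
  exact: sorted_filter ltn_trans _ _ (iota_ltn_sorted _ _).
by move=> i; rewrite mem_filter mem_iota /= add0n; case: (boolP (i \in I)) => // /Is ->.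
Qed.

(** A boolean test for being the one-line notation of a signed permutation; it is evaluated on
    concrete patterns. *)
Definition signed_word u :=
  uniq [seq `|z|%N | z <- u] && all (fun z : int => 0 < `|z| <= size u)%N u.

Lemma signed_word_one_line u : signed_word u -> exists v : sperm (size u), one_line v = u.
Proof.
move=> /andP[uu /allP/= u_all].
have u_le (i : nat) : (i < size u)%N -> (0 < absz (nth 0%R u i) <= size u)%N.
  by move=> iu; apply: u_all; exact: mem_nth.
have u_lt (i : 'I_(size u)) : ((absz (nth 0%R u i)).-1 < size u)%N.
  by have := u_le i (ltn_ord i); lia.
pose F (x : letter (size u)) : letter (size u) :=
  (x.1 (+) (u`_x.2 < 0), Ordinal (u_lt x.2)).
have Finj : injective F.
  move=> [b i] [c j] [bc ij].
  have {}ij : i = j.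
    apply/val_inj/eqP; rewrite /= -(nth_uniq 0%N _ _ uu) ?size_map //.
    rewrite !(nth_map 0) //; apply/eqP.
    have := u_le i (ltn_ord i); have := u_le j (ltn_ord j).
    by move=> /andP[pj _] /andP[pi _]; rewrite -(prednK pi) -(prednK pj) ij.
  by move: bc; rewrite ij => /addIb ->.
have FN x : perm Finj (letter_opp x) = letter_opp (perm Finj x).
  by rewrite !permE /F /letter_opp /= addNb.
exists (SPerm FN); apply: (@eq_from_nth _ 0); first by rewrite size_map size_enum_ord.
move=> i; rewrite size_map size_enum_ord => iu.
rewrite (nth_map (Ordinal iu)) ?size_enum_ord //= permE /F /letter_int /=.
rewrite nth_enum_ord // prednK; last by case/andP: (u_le i iu).
by rewrite [RHS]intEsign.
Qed.

Lemma size_one_line n (w : sperm n) : size (one_line w) = n.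
Proof. by rewrite size_map size_enum_ord. Qed.

Lemma stsP a u : size a = size u -> signed_word u ->
  sts a u <->
  (forall i, (i < size a)%N -> (u`_i < 0) = (a`_i < 0)) /\
  (forall i j, (i < j < size a)%N -> (`|u`_i| < `|u`_j|) = (`|a`_i| <= `|a`_j|)).
Proof.
move=> au /signed_word_one_line ex; split=> [[v [_ ? ?]]//|[h1 h2]].
by rewrite -au in ex; have [v vE] := ex; exists v.
Qed.

Lemma sts2 (a b u1 u2 : int) : signed_word [:: u1; u2] ->
  sts [:: a; b] [:: u1; u2] <->
  ((u1 < 0) = (a < 0) /\ (u2 < 0) = (b < 0)) /\ (`|u1| < `|u2|) = (`|a| <= `|b|).
Proof.
move=> wu; rewrite stsP //; split=> [[h1 h2]|[[h1 h2] h12]].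
  by rewrite (h1 0%N isT) (h1 1%N isT) (h2 0%N 1%N isT).
by split=> [[|[|i]]|[|[|i]] [|[|j]]] //=; rewrite ?andbF ?ltnS ?ltn0 ?andbF.
Qed.

Lemma sts4 (a b c d u1 u2 u3 u4 : int) : signed_word [:: u1; u2; u3; u4] ->
  sts [:: a; b; c; d] [:: u1; u2; u3; u4] <->
  ((u1 < 0) = (a < 0) /\ (u2 < 0) = (b < 0) /\
   (u3 < 0) = (c < 0) /\ (u4 < 0) = (d < 0)) /\
  ((`|u1| < `|u2|) = (`|a| <= `|b|) /\ (`|u1| < `|u3|) = (`|a| <= `|c|) /\
   (`|u1| < `|u4|) = (`|a| <= `|d|) /\ (`|u2| < `|u3|) = (`|b| <= `|c|) /\
   (`|u2| < `|u4|) = (`|b| <= `|d|) /\ (`|u3| < `|u4|) = (`|c| <= `|d|)).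
Proof.
move=> wu; rewrite stsP //.
split=> [[h1 h2]|[[? [? [? ?]]] [? [? [? [? [? ?]]]]]]].
  rewrite (h1 0%N isT) (h1 1%N isT) (h1 2%N isT) (h1 3%N isT).
  rewrite (h2 0%N 1%N isT) (h2 0%N 2%N isT) (h2 0%N 3%N isT).
  by rewrite (h2 1%N 2%N isT) (h2 1%N 3%N isT) (h2 2%N 3%N isT).
by split=> [[|[|[|[|i]]]]|[|[|[|[|i]]]] [|[|[|[|j]]]]] //=; rewrite ?andbF ?ltnS ?ltn0 ?andbF.
Qed.

Lemma contains2 a (u1 u2 : int) : contains a [:: u1; u2] <->
  exists i j, (i < j < size a)%N /\ sts [:: a`_i; a`_j] [:: u1; u2].
Proof.
split=> [[b /(subseq_nth 0)[I [sI Is ->]] st]|[i [j [/andP[ij ja] st]]]]; last first.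
  exists [:: a`_i; a`_j] => //; apply/(subseq_nth 0); exists [:: i; j].
  by rewrite /= ij ja (ltn_trans ij ja).
have sz : size I = 2.
  by have [v [/(congr1 size)]] := st; rewrite size_one_line size_map => <-.
case: I sz st sI Is => [|i [|j [|]]] //= _ st; rewrite !andbT => ij /andP[ia ja].
by exists i, j; rewrite ij ja.
Qed.

Lemma contains4 a (u1 u2 u3 u4 : int) : contains a [:: u1; u2; u3; u4] <->
  exists i j k l, [/\ (i < j)%N, (j < k)%N, (k < l < size a)%N
    & sts [:: a`_i; a`_j; a`_k; a`_l] [:: u1; u2; u3; u4]].
Proof.
split=> [[b /(subseq_nth 0)[I [sI Is ->]] st]|[i [j [k [l [ij jk /andP[kl la] st]]]]]];
    last first.
  exists [:: a`_i; a`_j; a`_k; a`_l] => //; apply/(subseq_nth 0); exists [:: i; j; k; l].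
  have ka := ltn_trans kl la; have ja := ltn_trans jk ka.
  by rewrite /= ij jk kl la ka ja (ltn_trans ij ja).
have sz : size I = 4.
  by have [v [/(congr1 size)]] := st; rewrite size_one_line size_map => <-.
case: I sz st sI Is => [|i [|j [|k [|l [|]]]]] //= _ st.
rewrite !andbT => /and3P[ij jk kl] /and4P[_ _ _ la].
by exists i, j, k, l; rewrite ij jk kl la.
Qed.

(** * Crossings of four letters, sorted by signs and absolute values *)

Section Quadruple.
Variables a b c d : int.
Hypotheses (a0 : a != 0) (b0 : b != 0) (c0 : c != 0) (d0 : d != 0).
Hypotheses (ab : `|a| != `|b|) (ac : `|a| != `|c|) (ad : `|a| != `|d|).
Hypotheses (bc : `|b| != `|c|) (bd : `|b| != `|d|) (cd : `|c| != `|d|).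

Definition crossing_word (p q r s : int) := (q < s /\ s < p /\ p < r) \/ (r < p /\ p < s /\ s < q).

Definition same_sign_patterns : seq (seq int) :=
  [:: [:: 3; 1; 4; 2]; [:: 2; 4; 1; 3]; [:: -3; -1; -4; -2]; [:: -2; -4; -1; -3]].

Definition mixed_patterns (z : int) : seq (seq int) :=
  if 0 < z then [:: [:: 1; 3; -4; 2]; [:: 2; -3; 4; 1];
                    [:: -1; 3; -4; 2]; [:: -2; 3; -4; 1]]
  else [:: [:: -1; -3; 4; -2]; [:: -2; 3; -4; -1];
           [:: 1; -3; 4; -2]; [:: 2; -3; 4; -1]].

Lemma same_sign_crossing u : u \in same_sign_patterns ->
  sts [:: a; b; c; d] u -> crossing_word a b c d.
Proof.
by rewrite !inE => /or4P[] /eqP -> /sts4 => /(_ isT); rewrite /crossing_word; lia.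
Qed.

Lemma mixed_crossing u : u \in mixed_patterns d ->
  sts [:: a; b; c; d] u -> crossing_word a b c d.
Proof.
rewrite /mixed_patterns; case: ifP => _; rewrite !inE => /or4P[] /eqP -> /sts4 => /(_ isT);
  rewrite /crossing_word; lia.
Qed.

(* For nonzero letters of distinct absolute values: the word [x y] has the
   pattern [-2 1] or [2 -1]. *)
Definition mixed_pair (x y : int) := (0 < y) != (0 < x + y).

(** Without mixed pairs among the first three letters, a change of sign there goes with growing
    absolute value. Together with the crossing inequalities this leaves few sign vectors, each with
    its order of absolute values nearly forced. *)
Lemma crossing_patterns : crossing_word a b c d ->
  ~~ mixed_pair a b -> ~~ mixed_pair a c -> ~~ mixed_pair b c ->
  (exists2 u, u \in same_sign_patterns & sts [:: a; b; c; d] u) \/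
  (exists2 u, u \in mixed_patterns d & sts [:: a; b; c; d] u).
Proof.
have pat (u1 u2 u3 u4 : int) (s : seq (seq int)) : [:: u1; u2; u3; u4] \in s ->
    signed_word [:: u1; u2; u3; u4] ->
    ((u1 < 0) = (a < 0) /\ (u2 < 0) = (b < 0) /\
     (u3 < 0) = (c < 0) /\ (u4 < 0) = (d < 0)) /\
    ((`|u1| < `|u2|) = (`|a| <= `|b|) /\ (`|u1| < `|u3|) = (`|a| <= `|c|) /\
     (`|u1| < `|u4|) = (`|a| <= `|d|) /\ (`|u2| < `|u3|) = (`|b| <= `|c|) /\
     (`|u2| < `|u4|) = (`|b| <= `|d|) /\ (`|u3| < `|u4|) = (`|c| <= `|d|)) ->
    exists2 u, u \in s & sts [:: a; b; c; d] u.
  by move=> us wu h; exists [:: u1; u2; u3; u4] => //; apply/sts4.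
rewrite /mixed_pair /mixed_patterns => -[] [h1 [h2 h3]] nab nac nbc.
  have [d1|d1] := ltrP 0 d.
    have [b1|b1] := ltrP 0 b.
      by left; apply: (pat 3 1 4 2) => //; lia.
    by right; apply: (pat 2 (-3) 4 1) => //; lia.
  have [c1|c1] := ltrP 0 c; last first.
    by left; apply: (pat (-2) (-4) (-1) (-3)) => //; lia.
  right; have [a1|a1] := ltrP 0 a; last by apply: (pat (-1) (-3) 4 (-2)) => //; lia.
  (* Only the comparison of the first and last absolute values remains free, which gives two
     patterns. *)
  have [da|da] := leP `|a| `|d|; first by apply: (pat 1 (-3) 4 (-2)) => //; lia.
  by apply: (pat 2 (-3) 4 (-1)) => //; lia.
have [d1|d1] := ltrP 0 d.
  have [c1|c1] := ltrP 0 c.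
    by left; apply: (pat 2 4 1 3) => //; lia.
  right; have [a1|a1] := ltrP 0 a; first by apply: (pat 1 3 (-4) 2) => //; lia.
  have [da|da] := leP `|a| `|d|; first by apply: (pat (-1) 3 (-4) 2) => //; lia.
  by apply: (pat (-2) 3 (-4) 1) => //; lia.
have [b1|b1] := ltrP 0 b; last first.
  by left; apply: (pat (-3) (-1) (-4) (-2)) => //; lia.
by right; apply: (pat (-2) 3 (-4) (-1)) => //; lia.
Qed.

(** Each of the eight exceptional patterns contains a mixed pair ending at its last letter, so only
    those of constant sign remain. *)
Lemma crossing_no_cut : crossing_word a b c d ->
  ~~ mixed_pair a b -> ~~ mixed_pair a c -> ~~ mixed_pair b c ->
  ~~ mixed_pair a d -> ~~ mixed_pair b d -> ~~ mixed_pair c d ->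
  exists2 u, u \in same_sign_patterns & sts [:: a; b; c; d] u.
Proof.
move=> cr nab nac nbc nad nbd ncd.
have [//|[u ud st]] := crossing_patterns cr nab nac nbc; exfalso.
move: ud st nab nac nbc nad nbd ncd; rewrite /mixed_pair /mixed_patterns.
by case: ifP => _; rewrite !inE => /or4P[] /eqP -> /sts4 => /(_ isT); lia.
Qed.

End Quadruple.
End Patterns.

(** * From heights and roots to the one-line notation *)

Section Words.
Variables (R : realFieldType) (n : nat) (w : sperm n).
Local Notation x := (one_line w).

Lemma one_line_ord (i : 'I_n) : x`_i = letter_int (w (false, i)).
Proof. by rewrite (nth_map i) ?size_enum_ord // nth_ord_enum. Qed.

Lemma height_sperm_mx (i : 'I_n) : height (sperm_mx R w) i = (x`_i)%:~R.
Proof. by rewrite /height rho_sperm_mx one_line_ord. Qed.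

Lemma abs_letter_int (y : letter n) : `|letter_int y| = (y.2.+1)%:Z.
Proof. by rewrite normrM normr_sign mul1r. Qed.

Lemma one_line_neq0 i : (i < n)%N -> x`_i != 0.
Proof.
by move=> ni; rewrite (one_line_ord (Ordinal ni)) -normr_eq0 abs_letter_int.
Qed.

Lemma one_line_abs_neq i j : (i < j)%N -> (j < n)%N -> `|x`_i| != `|x`_j|.
Proof.
move=> ij jn; have ni := ltn_trans ij jn.
rewrite (one_line_ord (Ordinal ni)) (one_line_ord (Ordinal jn)) !abs_letter_int.
apply/eqP => -[/val_inj/sperm_index_inj[] ij']; by rewrite ij' ltnn in ij.
Qed.

Lemma minimal_non_separable_word : (0 < n)%N ->
  minimal_non_separable (rootsB R n) (sperm_mx R w) <->
  [/\ exists i j, (i < j < n)%N /\ mixed_pair x`_i x`_j,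
      forall i j, (i < j)%N -> (j < n.-1)%N -> ~~ mixed_pair x`_i x`_j
    & forall i j k l, (i < j)%N -> (j < k)%N -> (k < l)%N -> (l < n)%N ->
        ~ crossing_word x`_i x`_j x`_k x`_l].
Proof.
move=> n0; rewrite (minimal_non_separableP n0); last exact: weyl_sperm_mx.
have cutE (i j : 'I_n) : mixed_inversion (height (sperm_mx R w)) i j = mixed_pair x`_i x`_j.
  by rewrite /mixed_inversion /mixed_pair !height_sperm_mx -intrD !ltr0z.
have crossE (i j k l : 'I_n) : crossing (height (sperm_mx R w)) i j k l <->
    crossing_word x`_i x`_j x`_k x`_l.
  rewrite /crossing /crossing_word !height_sperm_mx !ltr_int.
  by split=> -[[h1]|[h1]]; [move=> h2 h3; left|move=> h2 h3; right
    |case=> h2 h3; left|case=> h2 h3; right].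
split=> -[[i [j [ij cij]]] ncut ncross]; split.
- by exists i, j; rewrite ij ltn_ord -cutE.
- move=> k l kl ln; have ln' : (l < n)%N by lia.
  have kn := ltn_trans kl ln'.
  by apply/negP; rewrite -(cutE (Ordinal kn) (Ordinal ln')); exact: ncut.
- move=> a b c d ab bc cd dn.
  have cn := ltn_trans cd dn; have bn := ltn_trans bc cn; have an := ltn_trans ab bn.
  by move=> /(crossE (Ordinal an) (Ordinal bn) (Ordinal cn) (Ordinal dn)); exact: ncross.
- have /andP[ij' jn] := ij; have ni := ltn_trans ij' jn.
  by exists (Ordinal ni), (Ordinal jn); rewrite cutE.
- by move=> k l kl ln; rewrite cutE; apply/negP; exact: ncut.
- by move=> a b c d ab bc cd /crossE; exact: ncross.
Qed.

Lemma mixed_pairP (a b : int) : a != 0 -> b != 0 -> `|a| != `|b| ->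
  mixed_pair a b <-> sts [:: a; b] (if 0 < b then [:: -2; 1] else [:: 2; -1]).
Proof. by rewrite /mixed_pair => a0 b0 ab; case: ifP => b1; rewrite sts2 //; lia. Qed.

Lemma sts_mixed_pair (a b : int) u : u \in [:: [:: -2; 1]; [:: 2; -1]] ->
  a != 0 -> b != 0 -> sts [:: a; b] u -> mixed_pair a b.
Proof.
move=> + a0 b0; rewrite !inE /mixed_pair => /orP[] /eqP -> /sts2 => /(_ isT); lia.
Qed.

End Words.

(** * The characterization of minimal non-separable signed permutations by patterns *)

Theorem lemma3p7 (R : realFieldType) (n : nat) (w : sperm n) (hn : (2 <= n)%N) :
  minimal_non_separable (rootsB R n) (sperm_mx R w) <->
  ( (* (a) *)
    [/\ avoids (take n.-1 (one_line w)) [:: -2; 1],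
        avoids (take n.-1 (one_line w)) [:: 2; -1],
        avoids (one_line w) [:: 3; 1; 4; 2],
        avoids (one_line w) [:: 2; 4; 1; 3]
      & avoids (one_line w) [:: -3; -1; -4; -2] /\
        avoids (one_line w) [:: -2; -4; -1; -3]]
    /\
    (* (b) *)
    (exists i : nat, (1 <= i <= n.-1)%N /\
       sts [:: at_pos w i; at_pos w n]
           (if 0 < at_pos w n then [:: -2; 1] else [:: 2; -1]))
    /\
    (forall j k l : nat, (1 <= j)%N -> (j < k)%N -> (k < l)%N -> (l < n)%N ->
       forall u : seq int,
         u \in (if 0 < at_pos w n
                then [:: [:: 1; 3; -4; 2]; [:: 2; -3; 4; 1];
                         [:: -1; 3; -4; 2]; [:: -2; 3; -4; 1]]
                else [:: [:: -1; -3; 4; -2]; [:: -2; 3; -4; -1];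
                         [:: 1; -3; 4; -2]; [:: 2; -3; 4; -1]]) ->
         ~ sts [:: at_pos w j; at_pos w k; at_pos w l; at_pos w n] u)).
Proof.
have n0 : (0 < n)%N by lia.
have sx : size (one_line w) = n by exact: size_one_line.
rewrite (minimal_non_separable_word R w n0).
set x := one_line w in sx *.
have x0 i : (i < n)%N -> x`_i != 0 := @one_line_neq0 _ w i.
have xN i j : (i < j)%N -> (j < n)%N -> `|x`_i| != `|x`_j| := @one_line_abs_neq _ w i j.
rewrite /at_pos -/x.
split=> [[[i [j [/andP[ij jn] cij]]] ncut ncross]|].
(* Mixed pairs ending earlier are excluded, so the existing one ends at the last letter; this gives
   the index required in (b). *)
- have jE : j = n.-1.
    have [jn'|] := ltnP j n.-1; last by lia.
    by move: cij; rewrite (negPf (ncut i j ij jn')).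
  have avoid2 u1 u2 : [:: u1; u2] \in [:: [:: -2; 1]; [:: 2; -1]] ->
      avoids (take n.-1 x) [:: u1; u2].
    move=> up /contains2[k [l [/andP[kl]]]]; rewrite size_take sx.
    case: ifP => h ln; last by lia.
    rewrite !nth_take // ?(ltn_trans kl) // => st.
    have ln' : (l < n)%N by lia.
    have /negP := ncut k l kl ln; apply; apply: sts_mixed_pair up _ _ st; apply: x0 => //.
    exact: ltn_trans ln'.
  have avoid4 u1 u2 u3 u4 : [:: u1; u2; u3; u4] \in same_sign_patterns ->
      avoids x [:: u1; u2; u3; u4].
    move=> up /contains4[a [b [c [d [ab bc /andP[cd dx] st]]]]].
    rewrite sx in dx; apply: (ncross a b c d) => //.
    by apply: same_sign_crossing up st; (apply: x0 || apply: xN); lia.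
  split; first by split; [exact: avoid2..|exact: avoid4|exact: avoid4|split; exact: avoid4].
  split.
    exists i.+1; split; first by lia.
    by rewrite -jE; apply/mixed_pairP => //; [apply: x0; lia|exact: x0|exact: xN].
  move=> a b c a1 ab bc cn u up st.
  (* The positions in (b) count from 1, those of the sequence from 0. *)
  have [ab' bc' cd'] : [/\ a.-1 < b.-1, b.-1 < c.-1 & c.-1 < n.-1]%N by split; lia.
  have dn' : (n.-1 < n)%N by lia.
  apply: (ncross _ _ _ _ ab' bc' cd' dn').
  by apply: mixed_crossing up st; (apply: x0 || apply: xN); lia.
move=> [[a1 a2 a3 a4 [a5 a6]] [[i [/andP[i1 iN] st]] nmixed]].
have ncut k l : (k < l)%N -> (l < n.-1)%N -> ~~ mixed_pair x`_k x`_l.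
  move=> kl ln; apply/negP => ckl; have ln' : (l < n)%N by lia.
  have kn := ltn_trans kl ln'.
  have [h _] := mixed_pairP (x0 k kn) (x0 l ln') (xN k l kl ln').
  have in_take u1 u2 : sts [:: x`_k; x`_l] [:: u1; u2] -> contains (take n.-1 x) [:: u1; u2].
    move=> st'; apply/contains2; exists k, l.
    rewrite !nth_take ?(ltn_trans kl ln) // size_take sx kl.
    by case: ifP => h0; [rewrite ln|lia].
  by move: (h ckl); case: ifP => _ /in_take; [exact: a1|exact: a2].
have nsame u1 u2 u3 u4 : [:: u1; u2; u3; u4] \in same_sign_patterns ->
    avoids x [:: u1; u2; u3; u4].
  by rewrite !inE => /or4P[] /eqP ->.
split=> //.
  exists i.-1, n.-1; split; first by lia.
  by apply/mixed_pairP => //; [apply: x0; lia|apply: x0; lia|apply: xN; lia].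
move=> a b c d ab bc cd dn cr.
have cn := ltn_trans cd dn; have bn := ltn_trans bc cn; have an := ltn_trans ab bn.
have [ac bd] := (ltn_trans ab bc, ltn_trans bc cd); have ad := ltn_trans ac cd.
have same u : u \in same_sign_patterns -> ~ sts [:: x`_a; x`_b; x`_c; x`_d] u.
  move=> up st'; have [u1 [u2 [u3 [u4 uE]]]] : exists u1 u2 u3 u4, u = [:: u1; u2; u3; u4].
    by move: up; rewrite !inE => /or4P[] /eqP ->; do 4 eexists.
  apply: (nsame u1 u2 u3 u4); rewrite -uE // uE; apply/contains4.
  by exists a, b, c, d; rewrite -uE cd sx dn.
(* A crossing before the last letter involves no mixed pair at all, so it has constant sign and (a)
   excludes it; one ending at the last letter may also show an exceptional pattern, excluded by
   (b). *)
have [dn'|nd] := ltnP d n.-1.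
  have cn' := ltn_trans cd dn'; have bn' := ltn_trans bc cn'.
  have [||||||||||u] := crossing_no_cut _ _ _ _ _ _ _ _ _ _ cr (ncut _ _ ab bn')
    (ncut _ _ ac cn') (ncut _ _ bc cn') (ncut _ _ ad dn') (ncut _ _ bd dn') (ncut _ _ cd dn');
    try by (apply: x0 || apply: xN); lia.
  exact: same.
have dE : d = n.-1 by lia.
have cn' : (c < n.-1)%N by rewrite -dE.
have bn' := ltn_trans bc cn'.
have [||||||||||[u up]|[u]] := crossing_patterns _ _ _ _ _ _ _ _ _ _ cr (ncut _ _ ab bn')
  (ncut _ _ ac cn') (ncut _ _ bc cn'); try by (apply: x0 || apply: xN); lia.
- exact: same.
- rewrite dE => up; by apply: (nmixed a.+1 b.+1 c.+1 _ _ _ _ u up); lia.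
Qed.
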